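(* Let $Y$ be a connected, locally path connected, second countable, Hausdorff topological space and let $S\subset Y$ be skeletal such that $Y\setminus S$ is semi-locally simply connected. Let $p:\widetilde Y^S\to Y$ be the universal covering of $Y$ possibly branched over $S$. The following are equivalent: (i) $p:\widetilde Y^S\to Y$ is Galoisian; (ii) the branched covering $p:\widetilde Y^S\to Y$ has discrete fibers; (iii) $Y\setminus S$ is semi-locally simply connected in $Y$.
   Context: All topological spaces are Hausdorff, locally path connected and first countable. A subset $D$ of a space $X$ is locally connected in $X$ if $U\cap D$ is connected for every open connected $U\subset X$. A subset is portly in $X$ if it is open, dense and locally connected in $X$; a subset is skeletal if its complement is portly. A spread $p:X\to Y$ is a continuous map such that the connected components of preimages $p^{-1}(U)$ of open subsets $U\subset Y$ generate the topology of $X$. It is complete if for every $y\in\overline{p(X)}$ and every inclusion-increasing assignment $\chi$ associating to each open connected neighborhood $U$ of $y$ a connected component $\chi(U)$ of $p^{-1}(U)$, one has $\bigcap_U\chi(U)\neq\emptyset$. A completion of a spread $X\to Y$ is a complete spread $X'\to Y$ with an embedding $X\to X'$ over $Y$ whose image is open, dense and locally connected in $X'$; every spread has a completion, unique up to isomorphism. The ordinary locus $\mathrm{Ord}(Y)$ is the set of $y\in Y$ having an open neighborhood $U$ such that each connected component of $p^{-1}(U)$ is mapped homeomorphically onto $U$ by $p$, and $\mathrm{Ord}(X)=p^{-1}(\mathrm{Ord}(Y))$. A branched covering is a complete surjective spread $X\to Y$ with $X,Y$ connected and $\mathrm{Ord}(X)$, $\mathrm{Ord}(Y)$ portly in $X$,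 $Y$; it is possibly branched over $S$ if $Y\setminus\mathrm{Ord}(Y)\subset S$. $\Gamma(X/Y)$ denotes the group of homeomorphisms $\varphi$ of $X$ with $p\circ\varphi=p$. A branched covering $p:X\to Y$ is Galoisian if $\Gamma(X/Y)$ acts transitively on the fibers of $p$. A space $Z$ is semi-locally simply connected if every point $z$ has a neighborhood $U$ such that every loop in $U$ based at $z$ is null-homotopic in $Z$. The universal covering $\widetilde Y^S\to Y$ possibly branched over $S$ is the completion of the spread $\widetilde{Y\setminus S}\to Y$, where $\widetilde{Y\setminus S}$ is the universal covering of $Y\setminus S$. For an open subset $U$ of a space $Z$ and $x\in\overline U$, $\Omega(x,x,U)$ is the set of loops $\gamma:[0,1]\to Z$ with $\gamma(0)=\gamma(1)=x$ and $\gamma(]0,1[)\subset U$; two such loops are homotopic in $\Omega(x,x,U)$ if there is a fixed-ends homotopy $H$ between them with $H([0,1]\times]0,1[)\subset U$. A loop $\gamma\in\Omega(x,x,U)$ is almost trivial with respect to $U$ if for every open neighborhood $V$ of $x$ it is homotopic in $\Omega(x,x,U)$ to an element of $\Omega(x,x,V\cap U)$. An open subset $U$ of $Z$ is semi-locally simply connected at $x\in\overline U$ if there is a connected open neighborhood $V$ of $x$ such that every loop in $\Omega(x,x,V\cap U)$ is almost trivial with respect to $U$. $U$ is semi-locally simply connected in $Z$ if it is dense in $Z$ and semi-locally simply connected at every point of $Z$. *)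

(* Defs.v *)
(* [R : realType] is the field of real numbers, in which the
   unit interval parametrizing paths lives. *)
From HB Require Import structures.
From mathcomp Require Import all_boot all_order all_algebra.
From mathcomp Require Import all_classical all_reals all_analysis.
Set Implicit Arguments.
Unset Strict Implicit.
Unset Printing Implicit Defensive.
Import Order.TTheory GRing.Theory Num.Theory.
Import numFieldNormedType.Exports.
Local Open Scope classical_set_scope.
Local Open Scope ring_scope.

(* Paths and homotopies are total functions on [R] and [R * R] that only matter
   on the unit interval and the unit square: continuity is required there only,
   and values elsewhere are irrelevant. *)
Definition is_path (R : realType) (T : topologicalType) (x y : T)
    (g : R -> T) : Prop :=
  [/\ {within `[0, 1], continuous g}, g 0 = x & g 1 = y].

(* [H (s, t)]: [s] is the deformation parameter, [t] the path parameter. *)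
Definition is_homotopy (R : realType) (T : topologicalType) (x y : T)
    (g h : R -> T) (H : R * R -> T) : Prop :=
  [/\ {within `[0, 1] `*` `[0, 1], continuous H},
      {in `[0, 1], forall t, H (0, t) = g t},
      {in `[0, 1], forall t, H (1, t) = h t},
      {in `[0, 1], forall s, H (s, 0) = x} &
      {in `[0, 1], forall s, H (s, 1) = y}].

Definition null_homotopic (R : realType) (T : topologicalType) (x : T)
    (g : R -> T) : Prop :=
  exists H : R * R -> T, is_homotopy x x g (cst x) H.

Definition path_connected (R : realType) (T : topologicalType) (A : set T) :
    Prop :=
  forall x y, A x -> A y ->
    exists2 g : R -> T, is_path x y g & {in `[0, 1], forall t, A (g t)}.

Definition locally_path_connected (R : realType) (T : topologicalType) : Prop :=
  forall (x : T) (U : set T), nbhs x U ->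
    exists V, [/\ open_nbhs x V, V `<=` U & path_connected R V].

Definition first_countable (T : topologicalType) : Prop :=
  forall x : T, exists B : nat -> set T,
    (forall n, nbhs x (B n)) /\
    (forall U, nbhs x U -> exists n, B n `<=` U).

Definition standing_space (R : realType) (T : topologicalType) : Prop :=
  [/\ hausdorff_space T, locally_path_connected R T & first_countable T].

Definition simply_connected (R : realType) (T : topologicalType) : Prop :=
  [/\ [set: T] !=set0, path_connected R [set: T] &
      forall (x : T) (g : R -> T), is_path x x g -> null_homotopic x g].

Definition semi_locally_simply_connected (R : realType) (T : topologicalType) :
    Prop :=
  forall z : T, exists2 U : set T, nbhs z U &
    forall g : R -> T, is_path z z g -> {in `[0, 1], forall t, U (g t)} ->
      null_homotopic z g.

Definition locally_connected_in (X : topologicalType) (D : set X) : Prop :=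
  forall U : set X, open U -> connected U -> connected (U `&` D).

Definition portly (X : topologicalType) (D : set X) : Prop :=
  [/\ open D, dense D & locally_connected_in D].

Definition skeletal (X : topologicalType) (S : set X) : Prop := portly (~` S).

(* Components are nonempty: a component of [A] is that of some point of [A]. *)
Definition is_component (X : topologicalType) (A C : set X) : Prop :=
  exists2 x, A x & C = connected_component A x.

(* [G] is a subbasis of the topology of [X]. *)
Definition generates_topology (X : topologicalType) (G : set (set X)) : Prop :=
  forall A : set X, open A <->
    exists2 D : set (set X), D `<=` finI_from G id & A = \bigcup_(B in D) B.

Definition spread (X Y : topologicalType) (p : X -> Y) : Prop :=
  continuous p /\
  generates_topology
    [set C | exists2 U : set Y, open U & is_component (p @^-1` U) C].

Definition connected_open_nbhs (Y : topologicalType) (y : Y) : set (set Y) :=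
  [set U | open_nbhs y U /\ connected U].

(* Only the values of [chi] on connected open neighborhoods of [y] matter. *)
Definition complete_spread (X Y : topologicalType) (p : X -> Y) : Prop :=
  spread p /\
  forall y, closure (range p) y -> forall chi : set Y -> set X,
    (forall U, connected_open_nbhs y U ->
       is_component (p @^-1` U) (chi U)) ->
    (forall U V, connected_open_nbhs y U -> connected_open_nbhs y V ->
       U `<=` V -> chi U `<=` chi V) ->
    \bigcap_(U in connected_open_nbhs y) chi U !=set0.

Definition embedding (X Z : topologicalType) (i : X -> Z) : Prop :=
  injective i /\
  forall A : set X, open A <-> exists2 V : set Z, open V & A = i @^-1` V.

(* [i : X -> Z] exhibits [p : Z -> Y] as a completion of [f : X -> Y]. *)
Definition is_completion (X Z Y : topologicalType) (f : X -> Y) (p : Z -> Y)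
    (i : X -> Z) : Prop :=
  [/\ spread f, complete_spread p, embedding i, p \o i = f & portly (range i)].

Definition maps_homeomorphically (X Y : topologicalType) (p : X -> Y)
    (C : set X) (U : set Y) : Prop :=
  [/\ {within C, continuous p}, set_bij C U p &
      exists2 g : Y -> X, {within U, continuous g} & {in C, cancel p g}].

Definition OrdY (X Y : topologicalType) (p : X -> Y) : set Y :=
  [set y | exists2 U : set Y, open_nbhs y U &
     forall C, is_component (p @^-1` U) C -> maps_homeomorphically p C U].

Definition OrdX (X Y : topologicalType) (p : X -> Y) : set X :=
  p @^-1` OrdY p.

Definition branched_covering (X Y : topologicalType) (p : X -> Y) : Prop :=
  [/\ complete_spread p, range p = [set: Y],
      connected [set: X] /\ connected [set: Y],
      portly (OrdX p) & portly (OrdY p)].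

Definition Gamma (X Y : topologicalType) (p : X -> Y) : set (X -> X) :=
  [set phi | [/\ continuous phi,
     (exists psi, [/\ continuous psi, cancel phi psi & cancel psi phi]) &
     p \o phi = p]].

Definition Galoisian (X Y : topologicalType) (p : X -> Y) : Prop :=
  branched_covering p /\
  forall x x' : X, p x = p x' -> exists2 phi, Gamma p phi & phi x = x'.

(* Fibers carry the subspace topology. *)
Definition has_discrete_fibers (X Y : topologicalType) (p : X -> Y) : Prop :=
  forall (y : Y) (A : set (set_type (p @^-1` [set y]))), open A.

Definition covering (E B : topologicalType) (q : E -> B) : Prop :=
  [/\ continuous q, range q = [set: B] &
      forall b : B, exists2 U : set B, open_nbhs b U &
        exists V : set (set E),
          [/\ q @^-1` U = \bigcup_(W in V) W, trivIset V id &
              forall W, V W -> open W /\ maps_homeomorphically q W U]].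

Definition universal_covering (R : realType) (E B : topologicalType)
    (q : E -> B) : Prop :=
  covering q /\ simply_connected R E.

(* [set_type (~` S)] is the complement of [S] with its subspace topology, and
   [set_val] its inclusion into [Y]. *)
Definition universal_covering_possibly_branched_over (R : realType)
    (Y : topologicalType) (S : set Y) (X : topologicalType) (p : X -> Y) :
    Prop :=
  exists (E : topologicalType) (q : E -> set_type (~` S)) (i : E -> X),
    [/\ standing_space R E, universal_covering R q &
        is_completion (set_val \o q) p i].

(* Loops based at [x] that stay in [U] except possibly at their end points. *)
Definition Omega (R : realType) (Z : topologicalType) (x : Z) (U : set Z) :
    set (R -> Z) :=
  [set g | is_path x x g /\ {in `]0, 1[, forall t, U (g t)}].

Definition Omega_homotopic (R : realType) (Z : topologicalType) (x : Z)
    (U : set Z) (g h : R -> Z) : Prop :=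
  exists2 H : R * R -> Z, is_homotopy x x g h H &
    {in `[0, 1] & `]0, 1[, forall s t, U (H (s, t))}.

Definition almost_trivial (R : realType) (Z : topologicalType) (x : Z)
    (U : set Z) (g : R -> Z) : Prop :=
  forall V, open_nbhs x V ->
    exists2 h : R -> Z, Omega x (V `&` U) h & Omega_homotopic x U g h.

Definition semi_locally_simply_connected_at (R : realType)
    (Z : topologicalType) (U : set Z) (x : Z) : Prop :=
  exists2 V, connected_open_nbhs x V &
    forall g : R -> Z, Omega x (V `&` U) g -> almost_trivial x U g.

Definition semi_locally_simply_connected_in (R : realType)
    (Z : topologicalType) (U : set Z) : Prop :=
  dense U /\ forall x : Z, semi_locally_simply_connected_at R U x.

(* Main.v *)
(* The regular part [D = ~` S] is evenly covered by the simply connected space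
   [E], which sits in the completion [X] as the preimage of [D].  For a connected
   open [V] in [Y], every component of the preimage of [V] in [X] surjects onto
   [V] and has connected trace on [E].  Hence a fiber of [p] is the inverse limit
   of the sets of components of preimages of shrinking neighborhoods, and [p] is
   always a branched covering.

   - Deck transformations of [E] over [D] extend to [X] by completeness.  If some
     component of the preimage of [V] meets a discrete fiber in one point only,
     a deck transformation moving it onto another such component moves any point
     of the fiber to any other: discrete fibers imply Galoisian.
   - Conversely the automorphism group is countable, because [E -> D] has
     countable fibers, and a countable homogeneous fiber is discrete by a Baire
     argument.
   - Two points of a fiber lying in the same component over [V] are joined by a
     path in [X] whose interior lies in [E]; its image is a loop in [V] through
     [D], and this loop can be deformed into arbitrarily small neighborhoods
     exactly when the two points lie in the same component over each of them,
     that is, when they coincide. *)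
Require Import Defs.
From mathcomp Require Import all_boot all_order all_algebra.
From mathcomp Require Import all_classical all_reals all_analysis.
From mathcomp Require Import lra.
Set Implicit Arguments.
Unset Strict Implicit.
Unset Printing Implicit Defensive.
Import Order.TTheory GRing.Theory Num.Theory.
Import numFieldNormedType.Exports.
Local Open Scope classical_set_scope.
Local Open Scope ring_scope.

(** * Connectedness and paths *)

Section ContinuityAt.
Context {S T U : topologicalType}.

Lemma nbhs_preimage (f : S -> T) x A :
  {for x, continuous f} -> nbhs (f x) A -> nbhs x (f @^-1` A).
Proof. by move=> cf /cf. Qed.

Lemma continuous_atI (f : S -> T) x :
  (forall A, nbhs (f x) A -> nbhs x (f @^-1` A)) -> {for x, continuous f}.
Proof. by []. Qed.

Lemma continuous_fun_comp (f : S -> T) (g : T -> U) :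
  continuous f -> continuous g -> continuous (fun x => g (f x)).
Proof. by move=> cf cg x; apply: (continuous_comp (cf x)); exact: cg. Qed.

Lemma continuous_pair (f : S -> T) (g : S -> U) :
  continuous f -> continuous g -> continuous (fun x => (f x, g x)).
Proof.
move=> cf cg x A [[P Q] /= [fP gQ] PQA].
have fPgQ : nbhs x (f @^-1` P `&` g @^-1` Q).
  by apply: filterI; [apply: cf | apply: cg].
by apply: (filterS _ fPgQ) => y [Py Qy]; apply: PQA.
Qed.

Lemma open_preimage (f : S -> T) A :
  continuous f -> open A -> open (f @^-1` A).
Proof. by move=> /continuousP; apply. Qed.

Lemma open_nbhsP (x : S) A : open A -> A x -> nbhs x A.
Proof. by move=> oA Ax; exact: open_nbhs_nbhs. Qed.

Lemma openP (A : set S) : (forall x, A x -> nbhs x A) -> open A.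
Proof. by move=> nA; rewrite openE. Qed.

End ContinuityAt.

Section Connectedness.
Context {T : topologicalType}.
Implicit Types A P : set T.

Lemma connected_propagation A P (x0 : T) : connected A -> A x0 -> P x0 ->
  (forall x, A x -> exists2 J, nbhs x J &
     forall y z, A y -> J y -> P y -> A z -> J z -> P z) ->
  A `<=` P.
Proof.
move=> cA Ax0 Px0 loc.
suff -> : A = A `&` P by move=> x [].
apply/esym/cA; first by exists x0.
- exists [set z | A z -> P z]°; first exact: open_interior.
  apply/seteqP; split=> x [Ax]; last first.
    by move=> /interior_subset Px; split => //; exact: Px.
  move=> Px; split => //; have [J Jx JP] := loc x Ax.
  have Jx' := nbhs_singleton Jx.
  by apply: (filterS _ Jx) => z Jz Az; apply: (JP x z).
- exists (~` [set z | A z -> ~ P z]°).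
    exact/open_closedC/open_interior.
  apply/seteqP; split=> x [Ax].
    by move=> Px; split => // /interior_subset nP; exact: nP.
  move=> nP; split => //; apply: contrapT => nPx; apply: nP.
  have [J Jx JP] := loc x Ax.
  have Jx' := nbhs_singleton Jx.
  by apply: (filterS _ Jx) => z Jz Az Pz; apply: nPx; apply: (JP z x).
Qed.

(** A nonempty relatively clopen part of [B] meets [A] by density, hence contains [A], and contains
    [B] by relative closedness. *)
Lemma connected_between A B :
  connected A -> A `<=` B -> B `<=` closure A -> connected B.
Proof.
move=> cA AB BA U [u Uu] [W oW UW] [F cF BF].
have AU : A `<=` U.
  suff <- : A `&` U = A by move=> x [].
  apply: cA; first 1 last.
  - by exists W => //; rewrite UW setIA (setIidl AB).
  - by exists F => //; rewrite BF setIA (setIidl AB).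
  move: Uu; rewrite UW => -[Bu Wu].
  have [z [Az Wz]] := BA u Bu W (open_nbhs_nbhs (conj oW Wu)).
  by exists z; split => //; split => //; apply: AB.
apply/seteqP; split; first by rewrite UW => x [].
move=> x Bx; rewrite BF; split => //; apply: cF.
by apply: closureS (BA _ Bx) => z /AU; rewrite BF => -[].
Qed.

Lemma closure_dense A B : dense A -> open B -> B `<=` closure (B `&` A).
Proof.
move=> dA oB x Bx V Vx.
have [||z [[Vz Bz] Az]] := dA (V° `&` B).
- by exists x; split => //; apply: nbhs_interior.
- by apply: openI => //; apply: open_interior.
by exists z; split; [split | apply: interior_subset Vz].
Qed.

Lemma connected_imageT (S : topologicalType) (A : set S) (k : S -> T) :
  connected A -> continuous k -> connected (k @` A).
Proof.
by move=> cA ck; apply: connected_continuous_connected => //;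
  apply: continuous_subspaceT.
Qed.

End Connectedness.

Lemma eq_on_dense (S T : topologicalType) (A : set S) (u v : S -> T) :
  hausdorff_space T -> dense A -> continuous u -> continuous v ->
  (forall z, A z -> u z = v z) -> u = v.
Proof.
move=> hT dA cu cv uv; apply/funext => z; apply: hT => U V Uz Vz.
have [||w [/interior_subset[Uw Vw] Aw]] := dA (u @^-1` U `&` v @^-1` V)°.
- by exists z; apply: filterI; [apply: cu | apply: cv].
- exact: open_interior.
by exists (u w); split => //; rewrite uv.
Qed.

Lemma decreasing_sets (T : Type) (U : nat -> set T) :
  (forall n, U n.+1 `<=` U n) -> forall m n, (m <= n)%N -> U n `<=` U m.
Proof.
move=> US m n /subnK <-; elim: (n - m)%N => // k IH x.
by rewrite addSn => /US/IH.
Qed.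

(** * Paths, gluing and the unit interval *)

Section UnitInterval.
Context {R : realType}.

(** Retraction of the line onto the unit interval. Composing with it makes paths and homotopies
    globally continuous and removes subspace topologies from the arguments. *)
Definition clamp (t : R) : R := Num.max 0 (Num.min t 1).

Lemma clamp_in t : clamp t \in `[0, 1].
Proof. by rewrite in_itv /= /clamp le_max lexx ge_max ler01 ge_min lexx orbT. Qed.

Lemma clamp_id t : t \in `[0, 1] -> clamp t = t.
Proof.
by rewrite in_itv => /andP[t0 t1]; rewrite /clamp (min_idPl t1) (max_idPr t0).
Qed.

Lemma clamp_bounds t : 0 <= clamp t /\ clamp t <= 1.
Proof. by have := clamp_in t; rewrite in_itv => /andP. Qed.

Lemma clamp_le0 t : t <= 0 -> clamp t = 0.
Proof. by move=> t0; rewrite /clamp (min_idPl _) ?(max_idPl _)//; lra. Qed.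

Lemma clamp_ge1 t : 1 <= t -> clamp t = 1.
Proof. by move=> t1; rewrite /clamp (min_idPr _)// (max_idPr _)//; lra. Qed.

Lemma clamp0 : clamp 0 = 0.
Proof. by apply: clamp_id; rewrite in_itv /= lexx ler01. Qed.

Lemma clamp1 : clamp 1 = 1.
Proof. by apply: clamp_id; rewrite in_itv /= lexx ler01. Qed.

Lemma clampK t : clamp (clamp t) = clamp t.
Proof. exact/clamp_id/clamp_in. Qed.

Lemma clamp_continuous : continuous clamp.
Proof.
move=> t; apply: (@continuous_max R R (cst 0) (id \min cst 1)).
  exact: cvg_cst.
by apply: (@continuous_min R R id (cst 1)); [exact: cvg_id | exact: cvg_cst].
Qed.

(** For small [d] this cuts off both ends of a loop, the only places where a loop of [Omega] may
    leave its open set. *)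
Definition shrink (d t : R) : R := d + (1 - 2 * d) * clamp t.

Lemma shrink_continuous d : continuous (shrink d).
Proof.
move=> t; apply: cvgD; first exact: cvg_cst.
by apply: cvgMr; exact: clamp_continuous.
Qed.

Lemma shrink_bounds d t : d <= 2^-1 -> d <= shrink d t /\ shrink d t <= 1 - d.
Proof.
by move=> d2; have [t0 t1] := clamp_bounds t; rewrite /shrink; split; nra.
Qed.

Lemma shrink_clamp d t : shrink d (clamp t) = shrink d t.
Proof. by rewrite /shrink clampK. Qed.

Lemma shrink0 d : shrink d 0 = d.
Proof. by rewrite /shrink clamp0 mulr0 addr0. Qed.

Lemma shrink1 d : shrink d 1 = 1 - d.
Proof. by rewrite /shrink clamp1 mulr1; lra. Qed.

Lemma connectedR (A : set R) : is_interval A -> connected A.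
Proof. by move/connected_intervalP. Qed.

Lemma connectedRT : connected [set: R].
Proof. exact: connectedR. Qed.

Lemma clamp_path_continuous (T : topologicalType) (g : R -> T) :
  {within `[0, 1], continuous g} -> continuous (g \o clamp).
Proof.
move=> /subspace_continuousP cg t A Ag.
have cgA : nbhs (clamp t) [set u | u \in `[0, 1] -> A (g u)].
  exact: cg (clamp t) (clamp_in t) A Ag.
have := nbhs_preimage (@clamp_continuous t) cgA.
by apply: (@filterS _ (nbhs t)) => u; apply; exact: clamp_in.
Qed.

Lemma clamp_square_continuous (T : topologicalType) (H : R * R -> T) :
  {within `[0, 1] `*` `[0, 1], continuous H} ->
  continuous (fun z => H (clamp z.1, clamp z.2)).
Proof.
move=> /subspace_continuousP cH [s t] A AH /=.
have st : (`[0, 1] `*` `[0, 1]) (clamp s, clamp t).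
  by split; apply: clamp_in.
have cHA : nbhs (clamp s, clamp t) [set z | (`[0, 1] `*` `[0, 1]) z -> A (H z)].
  exact: cH _ st A AH.
have cc : continuous (fun z : R * R => (clamp z.1, clamp z.2)).
  by apply: continuous_pair; apply: continuous_fun_comp clamp_continuous => w;
    [exact: cvg_fst | exact: cvg_snd].
have := nbhs_preimage (cc (s, t)) cHA.
by apply: (@filterS _ (nbhs (s, t))) => u; apply; split; apply: clamp_in.
Qed.

(** Each piece has to be continuous only on its own closed side, which admits pieces built from
    local sections. *)
Lemma glue_continuous (S T : topologicalType) (d : S -> R) (a : R)
    (u v : S -> T) : continuous d ->
  (forall z, d z <= a -> {for z, continuous u}) ->
  (forall z, a <= d z -> {for z, continuous v}) ->
  (forall z, d z = a -> u z = v z) ->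
  continuous (fun z => if d z <= a then u z else v z).
Proof.
move=> cd cu cv uv z; apply: continuous_atI => A.
have [dza|adz|dza] := ltgtP (d z) a => /= Az.
- have d1 := nbhs_preimage (cd z) (lt_nbhsl dza).
  have u1 := nbhs_preimage (cu z (ltW dza)) Az.
  apply: (filterS _ (filterI d1 u1)) => w /= [dw uw].
  by rewrite (ltW (dw : _ < _)).
- have d1 := nbhs_preimage (cd z) (lt_nbhsr adz).
  have v1 := nbhs_preimage (cv z (ltW adz)) Az.
  apply: (filterS _ (filterI d1 v1)) => w /= [dw vw].
  by rewrite leNgt (dw : _ < _).
- have u1 : nbhs z (u @^-1` A) by apply: cu => //; rewrite dza.
  rewrite (uv z dza) in Az.
  have v1 : nbhs z (v @^-1` A) by apply: cv => //; rewrite dza.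
  apply: (filterS _ (filterI u1 v1)) => w /= [uw vw].
  by case: ifP.
Qed.

Definition path_in (T : topologicalType) (A : set T) (x y : T) :=
  exists g : R -> T, [/\ continuous g, g 0 = x, g 1 = y & forall t, A (g t)].

Lemma path_in_refl (T : topologicalType) (A : set T) x : A x -> path_in A x x.
Proof. by move=> Ax; exists (cst x); split => //; exact: cst_continuous. Qed.

Lemma path_in_trans (T : topologicalType) (A : set T) x y z :
  path_in A x y -> path_in A y z -> path_in A x z.
Proof.
move=> [f [cf f0 f1 Af]] [g [cg g0 g1 Ag]].
exists (fun t => if t <= 2^-1 then f (clamp (2 * t)) else g (clamp (2 * t - 1))).
split.
- apply: (@glue_continuous _ _ id) => [t|t _|t _|t ->].
  + exact: cvg_id.
  + apply: (continuous_fun_comp _ cf).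
    apply: (continuous_fun_comp _ clamp_continuous) => u.
    by apply: cvgMr; exact: cvg_id.
  + apply: (continuous_fun_comp _ cg).
    apply: (continuous_fun_comp _ clamp_continuous) => u.
    by apply: cvgB; [apply: cvgMr; exact: cvg_id | exact: cvg_cst].
  + by rewrite divff ?pnatr_eq0// subrr clamp0 clamp1 f1 g0.
- by rewrite invr_ge0 ler0n mulr0 clamp0.
- have -> : (1 <= 2^-1 :> R) = false by apply/negbTE; lra.
  by rewrite mulr1 (_ : 2 - 1 = 1) ?clamp1//; lra.
- by move=> t; case: ifP.
Qed.

Lemma path_inW (T : topologicalType) (A B : set T) x y :
  A `<=` B -> path_in A x y -> path_in B x y.
Proof. by move=> AB [f [? ? ? Af]]; exists f; split => // t; apply/AB/Af. Qed.

(** Paths inside [A n] are run during the time interval from [n] to [n + 1]. The resulting ray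
    approaches whatever the sets shrink to, even when that limit lies outside [T]. *)
Lemma infinite_path (T : topologicalType) (A : nat -> set T) :
  (forall n, A n.+1 `<=` A n) -> (forall n, A n !=set0) ->
  (forall n x y, A n x -> A n y -> path_in (A n) x y) ->
  exists r : R -> T, [/\ continuous r, forall u, A 0 (r u) &
    forall n u, n%:R <= u -> A n (r u)].
Proof.
move=> AS A0 pA; have /choice[e eA] n : exists x, A n x by exact: A0.
have /choice[h hP] n := pA n _ _ (eA n) (AS _ _ (eA n.+1)).
pose c n u := h n (clamp (u - n%:R)).
have cc n : continuous (c n).
  have [ch _ _ _] := hP n; apply: (continuous_fun_comp _ ch).
  apply: (continuous_fun_comp _ clamp_continuous) => u.
  by apply: cvgB; [exact: cvg_id | exact: cvg_cst].
have c_end n u : n.+1%:R <= u -> c n u = e n.+1.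
  move=> nu; have [_ _ <- _] := hP n; rewrite /c clamp_ge1//.
  by rewrite -natr1 in nu; lra.
have cA n u : A n (c n u) by have [_ _ _] := hP n; exact.
(* Concatenation of the pieces [c 0] to [c n], constant from time [n + 1] on. *)
pose G := fix G n := if n is m.+1 then
  fun u => if u <= m.+1%:R then G m u else c m.+1 u else c 0.
have GP n : continuous (G n) /\ forall u, n.+1%:R <= u -> G n u = e n.+1.
  elim: n => [|n [cG Ge]] /=; first by split => // u; exact: c_end.
  split.
    apply: (@glue_continuous _ _ id) => [u|u _|u _|u ->]; 
      [exact: cvg_id | exact: cG | exact: cc |].
    by rewrite Ge// /c subrr clamp0; have [_ -> _ _] := hP n.+1.
  move=> u nu; rewrite ifF ?c_end//; apply/negbTE; rewrite -ltNge.
  by apply: lt_le_trans nu; rewrite ltr_nat.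
have Gstab m n u : (m <= n)%N -> u <= m.+1%:R -> G n u = G m u.
  move=> /subnK <- um; elim: (n - m)%N => // k IH.
  rewrite addSn /= ifT ?IH//; apply: le_trans um _.
  by rewrite ler_nat ltnS leq_addl.
have GA n N u : n%:R <= u -> u < N.+1%:R -> A n (G N u).
  elim: N n u => [|N IH] n u nu uN /=.
    have : (n < 1)%N by rewrite -(ltr_nat R); apply: le_lt_trans uN.
    by rewrite ltnS leqn0 => /eqP ->; exact: cA.
  case: ifP => [uN1|_].
    have [uN2|uN2] := ltP u N.+1%:R; first exact: IH.
    rewrite (GP N).2//.
    have : (n <= N.+1)%N by rewrite -(ler_nat R); apply: le_trans uN1.
    by move=> nN; exact: (decreasing_sets AS nN).
  have nN : (n <= N.+1)%N by rewrite -ltnS -(ltr_nat R); apply: le_lt_trans uN.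
  exact: (decreasing_sets AS nN (cA _ _)).
have GA0 N u : A 0 (G N u).
  elim: N => [|N IH] /=; first exact: cA.
  by case: ifP => // _; exact: (decreasing_sets AS (leq0n _) (cA _ _)).
(* By [Gstab], partial concatenations agree as long as both are still running, so near [u] this
   function is a single [G m]. *)
exists (fun u => G (Num.trunc u) u); split => //.
- move=> u; apply: continuous_atI => N uN.
  set m := Num.trunc u in uN.
  have um : u < m.+1%:R by exact: truncnS_gt.
  have near_um : nbhs u [set v | v < m.+1%:R] by exact: lt_nbhsl.
  have GN : nbhs u (G m @^-1` N) by apply: (GP m).1.
  apply: filterS (filterI near_um GN) => v [/= vm]; rewrite /preimage /=.
  congr N; set k := Num.trunc v.
  have vk : v < k.+1%:R by exact: truncnS_gt.
  have [mk|/ltnW km] := leqP m k.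
    by rewrite (Gstab m k)// ltW.
  by rewrite (Gstab k m)// ltW.
- by move=> n u nu; apply: GA => //; exact: truncnS_gt.
Qed.

(** Compactness of the unit interval makes the width [e] uniform in [s]. *)
Lemma tube (T : topologicalType) (H : R * R -> T) (N : set T) (t0 : R) :
  continuous H -> open N -> (forall s, s \in `[0, 1] -> N (H (s, t0))) ->
  exists2 e : R, 0 < e &
    forall s t, s \in `[0, 1] -> `|t0 - t| < e -> N (H (s, t)).
Proof.
move=> cH oN HN.
have /compact_near_coveringP nc := @segment_compact R 0 1.
have : \forall t \near t0, `[0, 1]%classic `<=` (fun s => N (H (s, t))).
  apply: (nc R (nbhs t0) (fun t s => N (H (s, t)))) => s s01.
  have : nbhs (s, t0) (H @^-1` N) by apply: cH; apply: open_nbhsP => //; exact: HN.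
  move=> [[P Q] /= [sP tQ] PQN]; exists (P, Q) => //.
  by move=> [a b] ab; exact: (PQN (a, b)).
move=> /nbhs_ballP[e /= e0 eN]; exists e => // s t s01 te.
exact: (eN t te s s01).
Qed.

Lemma path_connected_path_in (T : topologicalType) (A : set T) x y :
  path_connected R A -> A x -> A y -> path_in A x y.
Proof.
move=> pA Ax Ay; have [g [cg g0 g1] Ag] := pA x y Ax Ay.
exists (g \o clamp); split => /=; rewrite ?clamp0 ?clamp1//.
- exact: clamp_path_continuous.
- by move=> t; apply/Ag/clamp_in.
Qed.

Lemma path_connected_connected (T : topologicalType) (A : set T) :
  path_connected R A -> connected A.
Proof.
move=> pA; have [->|/set0P[x Ax]] := eqVneq A set0; first exact: connected0.
suff -> : A = connected_component A x by exact: component_connected.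
apply/seteqP; split; last exact: connected_component_sub.
move=> y Ay; have [f [cf f0 f1 Af]] := path_connected_path_in pA Ax Ay.
exists (range f); last by exists 1.
split; [by exists 0 | by move=> _ [t _ <-] |].
exact: connected_imageT connectedRT cf.
Qed.

End UnitInterval.

Section LocallyPathConnected.
Context {R : realType} {T : topologicalType}.
Hypothesis lpcT : locally_path_connected R T.

Lemma lpc_connected_nbhs (x : T) U : nbhs x U ->
  exists V, [/\ open_nbhs x V, V `<=` U & connected V].
Proof.
move=> /lpcT[V [Vx VU pV]]; exists V; split => //.
exact: path_connected_connected pV.
Qed.

Lemma lpc_open_component (O : set T) x :
  open O -> open (connected_component O x).
Proof.
move=> oO; apply: openP => y Oxy.
have Oy : O y by apply: connected_component_sub Oxy.
have [V [[oV Vy] VO cV]] := lpc_connected_nbhs (open_nbhs_nbhs (conj oO Oy)).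
have := open_nbhs_nbhs (conj oV Vy); apply: (@filterS _ (nbhs y)) => z Vz.
by apply: connected_component_trans Oxy _; exists V.
Qed.

Lemma lpc_path_in (O : set T) x y :
  open O -> connected O -> O x -> O y -> @path_in R T O x y.
Proof.
move=> oO cO Ox; apply: (connected_propagation cO Ox) => [|z Oz].
  exact: path_in_refl.
have [V [[oV Vz] VO pV]] := lpcT (open_nbhs_nbhs (conj oO Oz)).
exists V; first exact: open_nbhs_nbhs.
move=> a b Oa Va xa Ob Vb; apply: path_in_trans xa _.
exact: path_inW VO (path_connected_path_in pV Va Vb).
Qed.

End LocallyPathConnected.

(** * Lifting along coverings *)

Section Coverings.
Context {E Y : topologicalType}.
Implicit Types (f : E -> Y) (D U : set Y) (W : set E) (V : set (set E)).

(** The inverse [g] is a total function, continuous at each point of [U]; for open [U] this is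
    continuity on the subspace. *)
Definition is_sheet f U W :=
  [/\ open W, (forall w, W w -> U (f w)) &
      exists g : Y -> E, [/\ forall u, U u -> W (g u),
        forall u, U u -> f (g u) = u, forall w, W w -> g (f w) = w &
        forall u, U u -> {for u, continuous g}]].

Definition evenly_covered f U V :=
  [/\ open U, f @^-1` U = \bigcup_(W in V) W, trivIset V id &
      forall W, V W -> is_sheet f U W].

(* [f : E -> Y] is a covering of the subset [D] of [Y]; keeping [Y] as codomain
   avoids the sigma type [set_type D] in all lifting arguments. *)
Definition covers f D :=
  [/\ continuous f, range f = D &
      forall y, D y -> exists U V, [/\ U y, U `<=` D & evenly_covered f U V]].

Lemma sheet_at f U V e : evenly_covered f U V -> U (f e) ->
  exists2 W, V W & W e.
Proof.
by move=> [_ fU _ _] Ufe; have : (f @^-1` U) e by []; rewrite fU => -[W]; exists W.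
Qed.

Lemma sheet_eq f U V W1 W2 e : evenly_covered f U V ->
  V W1 -> V W2 -> W1 e -> W2 e -> W1 = W2.
Proof. by move=> [_ _ dV _] V1 V2 W1e W2e; apply: dV => //; exists e. Qed.

Lemma sheet_inj f U W a b : is_sheet f U W -> W a -> W b -> f a = f b -> a = b.
Proof. by move=> [_ _ [g [_ _ gK _]]] Wa Wb fab; rewrite -(gK a)// fab gK. Qed.

Lemma sheet_image_open f U W (A : set E) : open U -> is_sheet f U W -> open A ->
  open (f @` (A `&` W)).
Proof.
move=> oU [oW WU [g [gW fg gK cg]]] oA; apply: openP => y [e [Ae We] <-{y}].
have Ue := WU e We.
have oAW : nbhs (g (f e)) (A `&` W).
  by rewrite gK//; apply: open_nbhsP => //; exact: openI.
have UAW : nbhs (f e) (U `&` g @^-1` (A `&` W)).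
  by apply: filterI; [exact: open_nbhsP | exact: nbhs_preimage (cg _ Ue) oAW].
apply: (filterS _ UAW) => u [Uu [Agu Wgu]].
by exists (g u) => //; exact: fg.
Qed.

Section Lifting.
Context {R : realType}.
Variables (f : E -> Y) (D : set Y).
Hypothesis fD : covers f D.

Lemma covers_in e : D (f e).
Proof. by case: fD => _ <- _; exists e. Qed.

Lemma lift_in_sheet (T : topologicalType) (A : set T) (k : T -> E) U V W z0 :
  evenly_covered f U V -> V W -> connected A -> continuous k ->
  (forall z, A z -> U (f (k z))) -> A z0 -> W (k z0) ->
  forall z, A z -> W (k z).
Proof.
move=> ev VW cA ck AU Az0 Wz0.
apply: (connected_propagation cA Az0) => // z Az.
have [W1 VW1 W1z] := sheet_at ev (AU z Az).
have [_ _ _ /(_ _ VW1)[oW1 _ _]] := ev.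
exists (k @^-1` W1).
  by apply: open_nbhsP => //; exact: open_preimage.
by move=> a b Aa W1a Wa Ab W1b; rewrite (sheet_eq ev VW VW1 Wa W1a).
Qed.

Lemma lift_unique (T : topologicalType) (A : set T) (k1 k2 : T -> E) z0 :
  connected A -> continuous k1 -> continuous k2 ->
  (forall z, A z -> f (k1 z) = f (k2 z)) -> A z0 -> k1 z0 = k2 z0 ->
  forall z, A z -> k1 z = k2 z.
Proof.
move=> cA ck1 ck2 fk Az0 kz0.
apply: (connected_propagation cA Az0) => // z Az.
have [_ _ /(_ _ (covers_in (k1 z)))[U [V [Uz _ ev]]]] := fD.
have [W1 VW1 W1z] := sheet_at ev Uz.
have [W2 VW2 W2z] : exists2 W, V W & W (k2 z).
  by apply: (sheet_at ev); rewrite -fk.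
have [_ _ _ sh] := ev.
exists (k1 @^-1` W1 `&` k2 @^-1` W2).
  by apply: filterI; apply: open_nbhsP => //; apply: open_preimage => //;
    [case: (sh _ VW1) | case: (sh _ VW2)].
move=> a b Aa [W1a W2a] ka Ab [W1b W2b].
apply: (sheet_inj (sh _ VW1)) => //; last exact: fk.
by rewrite (sheet_eq ev VW1 VW2 W1a)// ka.
Qed.

Lemma path_lift (h : R -> Y) e0 : continuous h -> (forall t, D (h t)) ->
  f e0 = h 0 ->
  exists k : R -> E,
    [/\ continuous k, k 0 = e0 & forall t, f (k t) = h (clamp t)].
Proof.
move=> ch hD fe0.
(* The clock stopped at time [t]: [u] is clamped to the interval from 0 to [t]. *)
pose c (t u : R) : R := Num.max 0 (Num.min u t).
have cP (t u : R) : 0 <= t ->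
    [\/ u <= 0 /\ c t u = 0, (0 <= u /\ u <= t) /\ c t u = u
      | t <= u /\ c t u = t].
  rewrite /c => t0; have [ut|/ltW tu] := leP u t; have [u0|/ltW u0] := leP u 0.
  - exact: Or31.
  - exact: Or32.
  - by apply: Or33; split => //; rewrite (max_idPr t0).
  - by apply: Or33; split => //; rewrite (max_idPr t0).
have cc t : continuous (c t).
  move=> u; apply: (@continuous_max R R (cst 0) (id \min cst t)).
    exact: cvg_cst.
  by apply: (@continuous_min R R id (cst t)); [exact: cvg_id | exact: cvg_cst].
(* [P t]: the path stopped at time [t] lifts. *)
pose P (t : R) := exists k : R -> E,
  [/\ continuous k, k 0 = e0 & forall u, f (k u) = h (c t u)].
have i01 : connected (`[0, 1]%classic : set R).
  exact: segment_connected.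
suff : (`[0, 1]%classic : set R) `<=` P by apply; rewrite /= in_itv /= ler01 lexx.
apply: (@connected_propagation _ _ P 0 i01).
- by rewrite /= in_itv /= ler01 lexx.
- exists (cst e0); split => //; first exact: cst_continuous.
  by move=> u; rewrite fe0; congr h; case: (cP 0 u (lexx 0)) => -[? ->]; lra.
move=> t0 t01.
have [_ _ /(_ _ (hD t0))[U [V [Ut0 UD ev]]]] := fD.
have [oU _ _ sh] := ev.
have /nbhs_ballP[e /= e0' eU] : nbhs t0 (h @^-1` U).
  by apply: ch; exact: open_nbhsP.
exists (ball t0 e); first exact: nbhsx_ballx.
rewrite /ball/= => y z; rewrite !in_itv/= => /andP[y0 y1] Jy [k [ck k0 fk]].
move=> /andP[z0 z1] Jz.
(* Going back in time, the known lift is simply stopped earlier. *)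
have [zy|yz] := leP z y.
  exists (k \o c z); split.
  - exact: continuous_fun_comp (cc z) ck.
  - by rewrite /= /c (min_idPl z0) maxxx.
  - move=> u /=; rewrite fk; congr h.
    by have := cP y (c z u) y0; case: (cP z u z0) => -[? ->] [] [? ->]; lra.
have cyy : c y y = y by rewrite /c minxx (max_idPr y0).
have [W VW Wy] : exists2 W, V W & W (k y).
  by apply: (sheet_at ev); rewrite fk cyy; exact: eU.
have [oW WU [g [gW fg gK cg]]] := sh _ VW.
have Uz u : y <= u -> U (h (c z u)).
  move=> yu; apply: eU; move: Jy Jz; rewrite /ball /= !ltr_distlC.
  by move=> /andP[? ?] /andP[? ?]; case: (cP z u z0) => -[? ->]; lra.
(* Going forward, the lift is continued by the section of the sheet reached at time [y]. *)
exists (fun u => if u <= y then k u else g (h (c z u))); split.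
- apply: (@glue_continuous _ _ _ id) => [t|t _|t yt|t ->].
  + exact: cvg_id.
  + exact: ck.
  + apply: continuous_atI => A /(nbhs_preimage (cg _ (Uz _ yt))).
    exact: (nbhs_preimage (continuous_fun_comp (cc z) ch (x := t))).
  + rewrite -[LHS](gK _ Wy) fk cyy; congr (g (h _)).
    by case: (cP z y z0) => -[? ->]; lra.
- by rewrite y0.
- move=> u; case: leP => uy; last by rewrite fg//; exact/Uz/ltW.
  rewrite fk; congr h.
  by case: (cP z u z0) => -[? ->]; case: (cP y u y0) => -[? ->]; lra.
Qed.

(** Each slice with [s] fixed is lifted as a path. Joint continuity is then propagated in the
    direction of [t], starting from the continuous initial edge [k0]. *)
Lemma homotopy_lift (H : R * R -> Y) (k0 : R -> E) : continuous H ->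
  (forall z, D (H z)) -> (forall s t, H (s, t) = H (s, clamp t)) ->
  continuous k0 -> (forall s, f (k0 s) = H (s, 0)) ->
  exists K : R * R -> E, [/\ continuous K, forall s, K (s, 0) = k0 s &
    forall z, f (K z) = H z].
Proof.
move=> cH HD Hc ck0 fk0.
have cHs s : continuous (fun t => H (s, t)).
  apply: (continuous_fun_comp _ cH); apply: continuous_pair => t.
    exact: cvg_cst.
  exact: cvg_id.
have /choice[K KP] s : exists k : R -> E,
    [/\ continuous k, k 0 = k0 s & forall t, f (k t) = H (s, t)].
  have [k [ck kk0 fk]] := path_lift (cHs s) (fun t => HD (s, t)) (fk0 s).
  by exists k; split => // t; rewrite fk -Hc.
exists (fun z => K z.1 z.2); split; last 2 first.
- by move=> s; have [] := KP s.
- by move=> [s t]; have [_ _ ->] := KP s.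
move=> [s0 t0].
(* Continuity in [s] at a single time of [J] keeps nearby slices in one sheet throughout [J], where
   the lift is the section composed with [H]. *)
have loc (t1 : R) : exists2 J : set R, nbhs t1 J & forall t t', J t ->
    {for s0, continuous (K ^~ t)} -> J t' ->
    {for (s0, t'), continuous (fun z : R * R => K z.1 z.2)}.
  have [_ _ /(_ _ (HD (s0, t1)))[U [V [U1 UD ev]]]] := fD.
  have [oU _ _ sh] := ev.
  have [[I J0] /= [Is0 /nbhs_ballP[e /= e0 eJ0]] IJU] :
      nbhs (s0, t1) (H @^-1` U).
    by apply: cH; exact: open_nbhsP.
  exists (ball t1 e); first exact: nbhsx_ballx.
  move=> t t' Jt ct Jt'.
  have HU s u : I s -> ball t1 e u -> U (H (s, u)).
    by move=> ? ?; apply: (IJU (s, u)); split => //; exact: eJ0.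
  have [W VW Wt] : exists2 W, V W & W (K s0 t).
    apply: (sheet_at ev); have [_ _ ->] := KP s0.
    by apply: HU => //; exact: nbhs_singleton.
  have [oW WU [g [gW fg gK cg]]] := sh _ VW.
  have Is0' : nbhs s0 [set s | I s /\ W (K s t)].
    by apply: filterI => //; apply: ct; exact: open_nbhsP.
  have KW s u : I s -> W (K s t) -> ball t1 e u -> K s u = g (H (s, u)).
    move=> sI sW uJ; have [ck _ fk] := KP s.
    suff Wsu : W (K s u) by rewrite -fk gK.
    apply: (lift_in_sheet ev VW _ ck _ Jt sW uJ).
      apply: connectedR => a b; rewrite /ball /= !ltr_distlC.
      move=> /andP[? ?] /andP[? ?].
      by move=> z /andP[? ?] /=; rewrite ltr_distlC; apply/andP; split; lra.
    by move=> v Jv; rewrite fk; exact: HU.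
  apply: continuous_atI => A /=.
  have [Is0I Ws0] := nbhs_singleton Is0'.
  rewrite KW// => /(nbhs_preimage (cg _ (HU _ _ Is0I Jt'))).
  move=> /(nbhs_preimage (cH _)) gHA.
  have IJ : nbhs (s0, t') ([set s | I s /\ W (K s t)] `*` ball t1 e).
    exists ([set s | I s /\ W (K s t)], ball t1 e) => //; split => //=.
    by apply: open_nbhsP => //; exact: ball_open.
  apply: (filterS _ (filterI gHA IJ)) => -[s u] [/= Agh [[sI sW] uJ]].
  by rewrite KW.
have ctT (t : R) : {for s0, continuous (K ^~ t)}.
  have := @connected_propagation _ setT [set t | {for s0, continuous (K ^~ t)}] 0
    connectedRT.
  apply => //=.
    apply: continuous_atI => A; have [_ -> _] := KP s0 => /(nbhs_preimage (ck0 s0)).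
    by apply: (@filterS _ (nbhs s0)) => s; rewrite /=; have [_ -> _] := KP s.
  move=> t1 _; have [J Jt1 JP] := loc t1; exists J => //.
  move=> a b _ Ja ca _ Jb; apply: continuous_atI => A.
  have := JP a b Ja ca Jb => /[apply] KA.
  have cp : continuous (fun s : R => (s, b)).
    by apply: continuous_pair => s; [exact: cvg_id | exact: cvg_cst].
  exact: (nbhs_preimage (cp s0) KA).
have [J Jt0 JP] := loc t0.
by apply: (JP t0 t0) => //; exact: nbhs_singleton.
Qed.

End Lifting.

End Coverings.

(** * Deck transformations and countable fibers *)

Lemma second_countable_seq (T : topologicalType) : @second_countable T ->
  exists b : nat -> set T, (forall n, open (b n)) /\
    forall x U, nbhs x U -> exists n, b n x /\ b n `<=` U.
Proof.
move=> [B /countable_injP[j jinj] [Bo Bb]].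
(* Integers that code no basic set give the empty set, which is open. *)
exists (fun n => xget set0 [set U | B U /\ j U = n]); split.
  by move=> n; case: xgetP => [U _ [/Bo]|_] //; exact: open0.
move=> x U /Bb[W /= [BW Wx] WU]; exists (j W).
case: xgetP => [W' _ [BW' jW]|/(_ W) []//].
by rewrite (_ : W' = W)//; apply: jinj; rewrite ?inE.
Qed.

Section SimplyConnected.
Context {R : realType} {E Y : topologicalType}.
Hypothesis scE : simply_connected R E.

(** Simple connectedness contracts loops only; it is applied to the loop [l] that runs along [u] and
    back along [v], and the contraction is reparametrized with both ends fixed. *)
Lemma simply_connected_paths (a b : E) (u v : R -> E) :
  continuous u -> continuous v -> u 0 = a -> v 0 = a -> u 1 = b -> v 1 = b ->
  exists K : R * R -> E,
    [/\ continuous K, forall t, K (0, t) = u (clamp t),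
        forall t, K (1, t) = v (clamp t),
        forall s, K (s, 0) = a /\ K (s, 1) = b &
        forall s t, K (s, t) = K (s, clamp t)].
Proof.
move=> cu cv u0 v0 u1 v1.
pose l (t : R) := if t <= 2^-1 then u (clamp (2 * t)) else v (clamp (2 - 2 * t)).
have [_ _ sc] := scE.
have lc : continuous l.
  apply: (@glue_continuous _ _ _ id) => [t|t _|t _|t ->].
  - exact: cvg_id.
  - apply: (continuous_fun_comp _ cu).
    apply: (continuous_fun_comp _ clamp_continuous) => z.
    by apply: cvgMr; exact: cvg_id.
  - apply: (continuous_fun_comp _ cv).
    apply: (continuous_fun_comp _ clamp_continuous) => z.
    by apply: cvgB; [exact: cvg_cst | apply: cvgMr; exact: cvg_id].
  - by rewrite divff ?pnatr_eq0// (_ : 2 - 1 = 1) ?clamp1 ?u1 ?v1//; lra.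
have [L [cL L0 L1 Ls0 Ls1]] : null_homotopic a l.
  apply: sc; split; first exact: continuous_subspaceT.
  - by rewrite /l invr_ge0 ler0n mulr0 clamp0.
  - rewrite /l (_ : (1 <= 2^-1 :> R) = false); last by apply/negbTE; lra.
    by rewrite mulr1 subrr clamp0.
pose L' z := L (clamp z.1, clamp z.2).
have cL' : continuous L' by exact: clamp_square_continuous.
(* Polar coordinates in the square around [(0, 1/2)]: [(b1, b2)] runs through the
   three sides on which [L] is constant, and [phi] contracts them to the center,
   reaching the side carrying the loop along its two halves [u] and [v]. *)
pose b1 (s : R) := Num.min (clamp (3 * s)) (clamp (3 - 3 * s)).
pose b2 (s : R) := clamp (3 * s - 1).
pose phi (z : R * R) := ((1 - clamp z.2) * b1 z.1,
  2^-1 + (1 - clamp z.2) * (b2 z.1 - 2^-1)).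
have cb1 : continuous b1.
  move=> s; apply: (@continuous_min R R (fun s => clamp (3 * s))
      (fun s => clamp (3 - 3 * s))).
    apply: (continuous_fun_comp _ clamp_continuous) => z.
    by apply: cvgMr; exact: cvg_id.
  apply: (continuous_fun_comp _ clamp_continuous) => z.
  by apply: cvgB; [exact: cvg_cst | apply: cvgMr; exact: cvg_id].
have cb2 : continuous b2.
  apply: (continuous_fun_comp _ clamp_continuous) => z.
  by apply: cvgB; [apply: cvgMr; exact: cvg_id | exact: cvg_cst].
have cfst : continuous (fst : R * R -> R) by move=> z; exact: cvg_fst.
have csnd : continuous (snd : R * R -> R) by move=> z; exact: cvg_snd.
have c1 : continuous (fun z : R * R => 1 - clamp z.2).
  move=> z; apply: cvgB; first exact: cvg_cst.
  exact: (continuous_fun_comp csnd clamp_continuous).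
have cphi : continuous phi.
  apply: continuous_pair => z.
    apply: cvgM; first exact: c1.
    exact: (continuous_fun_comp cfst cb1).
  apply: cvgD; first exact: cvg_cst.
  apply: cvgM; first exact: c1.
  apply: cvgB; last exact: cvg_cst.
  exact: (continuous_fun_comp cfst cb2).
have clampE (t : R) : 0 <= t -> t <= 1 -> clamp t = t.
  by move=> t0 t1; rewrite clamp_id// in_itv /= t0 t1.
have LlE (t : R) : L (0, clamp t) = l (clamp t) by apply: L0; exact: clamp_in.
exists (fun z => L' (phi z)); split.
- exact: continuous_fun_comp cphi cL'.
- move=> t; have [t0 t1] := clamp_bounds t; rewrite /L' /= /b1 /b2.
  rewrite mulr0 clamp0 (min_idPl _); last by have [] := clamp_bounds (3 - 0 : R).
  rewrite mulr0 clamp0 LlE (@clamp_le0 R (0 - 1)); last lra.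
  rewrite clampE; [|lra|lra].
  rewrite /l (_ : _ <= _ = true); last by apply/idP; lra.
  by congr u; rewrite -[RHS]clampK; congr clamp; lra.
- move=> t; have [t0 t1] := clamp_bounds t.
  rewrite /L' /= /b1 /b2 !mulr1 subrr clamp0.
  rewrite (min_idPr _); last by have [] := clamp_bounds (3 : R).
  rewrite mulr0 clamp0 LlE (@clamp_ge1 R (3 - 1)); last lra.
  rewrite clampE; [|lra|lra].
  rewrite /l; case: ifPn => [le|_].
    have -> : clamp t = 1 by lra.
    by rewrite (_ : 2 * _ = 1) ?clamp1 ?u1 ?v1//; lra.
  by congr v; rewrite -[RHS]clampK; congr clamp; lra.
- move=> s; rewrite /L' /phi /= clamp0 clamp1 subrr !mul0r addr0 clamp0 subr0.
  rewrite !mul1r.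
  split; last first.
    rewrite (clampE 2^-1); [|lra|lra].
    have := LlE 2^-1; rewrite (clampE 2^-1); [|lra|lra] => ->.
    by rewrite /l lexx divff ?pnatr_eq0// clamp1.
  have e2 : 2^-1 + (b2 s - 2^-1) = b2 s by lra.
  rewrite e2 {1}/b2 clampK -/(b2 s).
  have [s1|s1] := leP (3 * s - 1) 0.
    by rewrite /b2 (clamp_le0 s1) Ls0// clamp_in.
  have [s2|s2] := leP 1 (3 * s - 1).
    by rewrite /b2 (clamp_ge1 s2) Ls1// clamp_in.
  rewrite /b1 (@clamp_ge1 R (3 * s)) ?(@clamp_ge1 R (3 - 3 * s)) ?minxx ?clamp1;
    [|lra..].
  by rewrite L1// clamp_in.
- by move=> s t; rewrite /phi /= clampK.
Qed.

(** The image of a path from [e] to [z] is lifted from [e'], and [g z] is the end of the lift.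
    Invertibility is obtained later by exchanging [e] and [e']. *)
Lemma deck_transformation (f : E -> Y) (D : set Y) (e e' : E) :
  locally_path_connected R E -> covers f D -> f e = f e' ->
  exists g : E -> E, [/\ continuous g, forall z, f (g z) = f z & g e = e'].
Proof.
move=> lpcE fD fee'; have [cf fr _] := fD; have [_ pE _] := scE.
(* Related points are the ends of two paths with the same image: a path in the
   fiber product of [f] with itself. *)
pose F := [set c : E * E | f c.1 = f c.2].
pose rel z w := @path_in R _ F (e, e') (z, w).
have cfst : continuous (fst : E * E -> E) by move=> z; exact: cvg_fst.
have csnd : continuous (snd : E * E -> E) by move=> z; exact: cvg_snd.
have Dcov z : D (f z) by apply: (covers_in fD).
have relT z : exists w, rel z w.
  have [u [cu u0 u1 _]] : @path_in R _ setT e z by apply: path_connected_path_in.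
  have [|||k [ck k0 fk]] := @path_lift _ _ R _ _ fD (f \o u) e'.
  - exact: continuous_fun_comp.
  - by move=> t; exact: Dcov.
  - by rewrite /= u0.
  exists (k 1), (fun t => (u (clamp t), k t)); split.
  - by apply: continuous_pair => //; exact: continuous_fun_comp clamp_continuous cu.
  - by rewrite clamp0 u0 k0.
  - by rewrite clamp1 u1.
  - by move=> t; rewrite /F /= fk.
(* Two paths from [e] to [z] are homotopic. The image of the homotopy, lifted from [e'], has its end
   in the fiber over [f z]; uniqueness of lifts makes that end constant. *)
have rel_fun z w1 w2 : rel z w1 -> rel z w2 -> w1 = w2.
  move=> [h1 [ch1 h10 h11 Fh1]] [h2 [ch2 h20 h21 Fh2]].
  have [||||||K [cK K0 K1 Ks Kc]] :=
    @simply_connected_paths e z (fst \o h1) (fst \o h2).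
  - exact: continuous_fun_comp ch1 cfst.
  - exact: continuous_fun_comp ch2 cfst.
  - by rewrite /= h10.
  - by rewrite /= h20.
  - by rewrite /= h11.
  - by rewrite /= h21.
  have [|||||k [ck k0 fk]] :=
      @homotopy_lift _ _ R _ _ fD (fun z => f (K z)) (cst e').
  - exact: continuous_fun_comp.
  - by move=> ?; exact: Dcov.
  - by move=> s t; rewrite -Kc.
  - exact: cst_continuous.
  - by move=> s; have [-> _] := Ks s.
  have slice s : continuous (fun t : R => k (s, t)).
    by apply: (continuous_fun_comp _ ck); apply: continuous_pair => t;
      [exact: cvg_cst | exact: cvg_id].
  have end_ s (h : R -> E * E) : continuous h -> h 0 = (e, e') ->
      (forall t, F (h t)) ->
      (forall t, K (s, t) = (h (clamp t)).1) -> k (s, 1) = (h 1).2.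
    move=> ch h0 Fh Kh.
    have := @lift_unique _ _ _ _ fD R setT (fun t => k (s, t))
      (fun t => (h (clamp t)).2) 0 connectedRT (slice s).
    rewrite -[in (h 1).2]clamp1; apply => //.
    - apply: (continuous_fun_comp _ csnd).
      exact: continuous_fun_comp clamp_continuous ch.
    - by move=> t _; rewrite fk Kh; exact: Fh.
    - by rewrite k0 clamp0 h0.
  have e1 : k (0, 1) = w1 by rewrite (end_ 0 h1)// h11.
  have e2 : k (1, 1) = w2 by rewrite (end_ 1 h2)// h21.
  rewrite -e1 -e2; apply/esym.
  apply: (@lift_unique _ _ _ _ fD R setT (fun s => k (s, 1)) (cst (k (0, 1))) 0
    connectedRT) => //.
  - by apply: (continuous_fun_comp _ ck); apply: continuous_pair => t;
      [exact: cvg_id | exact: cvg_cst].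
  - exact: cst_continuous.
  - by move=> s _ /=; rewrite !fk; have [_ ->] := Ks s; have [_ ->] := Ks 0.
have [g gP] := choice relT.
have relF z w : rel z w -> f z = f w.
  by move=> [h [_ _ h1 /(_ 1)]]; rewrite h1.
exists g; split; last first.
- by apply: (rel_fun e) => //; apply: path_in_refl.
- by move=> z; rewrite -(relF _ _ (gP z)).
move=> z; have [_ _ /(_ _ (Dcov z))[U [V [Uz _ ev]]]] := fD.
have [W VW Wz] := sheet_at ev Uz.
have [W' VW' W'z] : exists2 W', V W' & W' (g z).
  by apply: (sheet_at ev); rewrite -(relF _ _ (gP z)).
have [_ _ _ sh] := ev.
have [oW WU _] := sh _ VW.
have [oW' WU' [g' [gW fg gK cg]]] := sh _ VW'.
have [N [[oN Nz] NW pN]] := lpcE z W (open_nbhsP oW Wz).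
(* Near [z], transport continues along paths inside [N] and follows the local section [g'], whence
   continuity. *)
have gE x : N x -> g x = g' (f x).
  move=> Nx; apply: (rel_fun x (g x)); first exact: gP.
  apply: path_in_trans (gP z) _.
  have [d [cd d0 d1 Nd]] := @path_connected_path_in R _ N z x pN Nz Nx.
  exists (fun t => (d t, g' (f (d t)))); split.
  - apply: continuous_pair => // t; apply: continuous_atI => A.
    move/(nbhs_preimage (cg _ (WU _ (NW _ (Nd t))))).
    exact: (nbhs_preimage (continuous_fun_comp cd cf (x := t))).
  - by rewrite d0 (relF _ _ (gP z)) gK.
  - by rewrite d1.
  - by move=> t; rewrite /F /= fg//; exact/WU/NW.
apply: continuous_atI => A; rewrite gE//.
move/(nbhs_preimage (cg _ (WU _ (NW _ Nz))))/(nbhs_preimage (cf z)) => fA.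
apply: (filterS _ (filterI fA (open_nbhsP oN Nz))) => x [gA /gE].
by rewrite /= => ->.
Qed.

End SimplyConnected.

Section CountableFibers.
Context {E Y : topologicalType}.
Variables (f : E -> Y) (D : set Y).
Hypotheses (fD : covers f D) (Y2 : @second_countable Y).
Hypothesis cE : connected [set: E].

(* Poincare-Volterra: a sheet [W] and a basic open set [b j] contained in the
   image of [W `&` W'] determine the sheet [W'], so that chains of overlapping
   sheets are coded by finite sequences of pairs of integers. *)
Lemma countable_fiber (e0 : E) : exists j : seq (nat * nat) -> E,
  forall e, f e = f e0 -> exists s, e = j s.
Proof.
have [b [bo bP]] := second_countable_seq Y2.
have [cf _ loc] := fD.
pose ok n (UV : set Y * set (set E)) :=
  evenly_covered f UV.1 UV.2 /\ b n `<=` UV.1.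
(* Fixing one even covering per basic open set leaves only countably many families of sheets to
   code. *)
pose UV n := xget (set0, set0) (ok n).
have UVP n UV0 : ok n UV0 -> ok n (UV n).
  by move=> okn; apply: (xgetPex _ (ex_intro _ _ okn)).
have UVat e : exists n, [/\ b n (f e), ok n (UV n) & exists2 W, (UV n).2 W & W e].
  have [U [V [Ue _ ev]]] := loc _ (covers_in fD e).
  have [oU _ _ _] := ev.
  have [n [bn bnU]] := bP _ _ (open_nbhsP oU Ue).
  have [ev' bU] : ok n (UV n) by apply: (UVP n (U, V)).
  by exists n; split => //; apply: (sheet_at ev'); exact: bU.
have [n0 [_ [ev0 _] [W0 VW0 W0e]]] := UVat e0.
pose step W (kj : nat * nat) : set (set E) := [set W' |
  [/\ ok kj.1 (UV kj.1), (UV kj.1).2 W', b kj.2 !=set0 &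
      b kj.2 `<=` f @` (W `&` W')]].
pose fix r (s : seq (nat * nat)) :=
  if s is kj :: s' then xget W0 (step (r s') kj) else W0.
have rsheet s : exists2 U, open U & is_sheet f U (r s).
  have sh0 : exists2 U, open U & is_sheet f U W0.
    by have [oU _ _ sh] := ev0; exists (UV n0).1 => //; exact: sh.
  case: s => [//|kj s] /=; case: xgetP => [W' _ [[[oU _ _ sh] _] VW' _ _]|//].
  by exists (UV kj.1).1 => //; exact: sh.
have stepE s kj W' : step (r s) kj W' -> r (kj :: s) = W'.
  move=> st; rewrite /=; case: xgetP => [W'' _ st'|/(_ _ st)//].
  case: st st' => [[ev _] VW' [y by_] sub] [_ VW'' _ sub'].
  have [a [ra W'a] fa] := sub y by_; have [c [rc W''c] fc] := sub' y by_.
  have [U _ sh] := rsheet s.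
  have ac : a = c by apply: (sheet_inj sh) => //; rewrite fa fc.
  by rewrite -ac in W''c; exact: (sheet_eq ev VW'' VW' W''c W'a).
have reach : [set: E] `<=` [set e | exists s, r s e].
  apply: (connected_propagation cE (x0 := e0)) => //; first by exists [::].
  move=> x _; have [k [_ okk [W VW Wx]]] := UVat x.
  have [[oU _ _ sh] _] := okk; have [oW _ _] := sh _ VW.
  exists W; first exact: open_nbhsP.
  move=> y z _ Wy [s rsy] _ Wz.
  have [U' oU' rs] := rsheet s; have [ors _ _] := rs.
  have orW : open (f @` (r s `&` W)).
    exact: (sheet_image_open oU (sh _ VW) ors).
  have [j [bj bjW]] : exists j, b j (f y) /\ b j `<=` f @` (r s `&` W).
    by apply: bP; apply: open_nbhsP => //; exists y.
  exists ((k, j) :: s); rewrite (stepE s (k, j) W)//.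
  by split => //; exists (f y).
(* A sheet meets the fiber at most once, so the last sheet of the chain determines the point; [e0]
   is the default. *)
exists (fun s => xget e0 [set e | r s e /\ f e = f e0]) => e fe.
have [//|s rse] := reach e; exists s.
case: xgetP => [x _ [rx fx]|/(_ e)[]//].
by have [U _ sh] := rsheet s; apply: (sheet_inj sh) => //; rewrite fe fx.
Qed.

End CountableFibers.

(** * Coverings of open subsets, portly subsets and embeddings *)

Lemma covers_of_covering (E Y : topologicalType) (D : set Y)
    (q : E -> set_type D) :
  open D -> E -> covering q -> covers (set_val \o q) D.
Proof.
move=> oD e0 [cq rq loc].
have cval : continuous (set_val : set_type D -> Y) by exact: initial_continuous.
split.
- exact: continuous_fun_comp cq cval.
- apply/seteqP; split=> [_ [e _ <-]|y Dy]; first exact: set_valP.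
  have : range q (SigSub (mem_set Dy)) by rewrite rq.
  by move=> [e _ qe]; exists e => //=; rewrite qe.
move=> y Dy; have [U [oU Uy] [V [qU dV hV]]] := loc (SigSub (mem_set Dy)).
have [P oP PU] : exists2 P : set Y, open P & set_val @^-1` P = U by [].
exists (P `&` D), V; split.
- by split => //; move: Uy; rewrite -PU.
- by move=> ? [].
have fE e : (P `&` D) (set_val (q e)) <-> U (q e).
  by rewrite -PU; split=> [[]//|?]; split => //; exact: set_valP.
split => //.
- exact: openI.
- by rewrite -qU; apply/seteqP; split => e /fE.
move=> W VW; have [oW [_ [Wfun Winj Wsurj] [g cg gK]]] := hV W VW.
split => //; first by move=> w Ww; apply/fE/Wfun.
(* The section on the subtype is extended by the default [e0] off [D]; openness of [D] makes the
   extension continuous at points of [D]. *)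
pose g' y := if pselect (D y) is left Dy then g (SigSub (mem_set Dy)) else e0.
have g'E (b : set_type D) : g' (set_val b) = g b.
  rewrite /g'; case: pselect => [Db|]; last by have := set_valP b.
  by congr g; apply: val_inj.
have memU u : (P `&` D) u -> exists2 b, U b & u = set_val b.
  by move=> [Pu Du]; exists (SigSub (mem_set Du)); rewrite -?PU.
exists g'; split.
- move=> u /memU[b /Wsurj[w Ww <-] ->]; rewrite g'E gK ?inE//.
- move=> u /memU[b /Wsurj[w Ww <-] ->] /=; rewrite g'E gK ?inE//.
- by move=> w Ww /=; rewrite g'E gK ?inE.
move=> u /memU[b Ub ->]; apply: continuous_atI => A; rewrite g'E => Agb.
have gA : nbhs b [set c | U c -> A (g c)].
  by move/subspace_continuousP : cg; apply.
have : nbhs b (U `&` [set c | U c -> A (g c)]).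
  by apply: filterI => //; exact: open_nbhsP.
move=> [_ [[P' oP' <-] P'b] sub].
have : nbhs (set_val b) (P' `&` D).
  by apply: open_nbhsP; [exact: openI | split => //; exact: set_valP].
apply: filterS => z [P'z Dz].
have -> : z = set_val (SigSub (mem_set Dz) : set_type D) by [].
by rewrite /preimage /= g'E; have [Uz] := sub (SigSub (mem_set Dz)) P'z; apply.
Qed.

(** For connected open [U], the trace of [B] on [U] lies between the connected trace of [A] and its
    closure. *)
Lemma portly_sup (T : topologicalType) (A B : set T) :
  portly A -> open B -> A `<=` B -> portly B.
Proof.
move=> [oA dA lA] oB AB; split => //.
  move=> W W0 oW; have [z [Wz Az]] := dA W W0 oW.
  by exists z; split => //; exact: AB.
move=> U oU cU; apply: (connected_between (lA U oU cU)).
  by move=> z [Uz /AB].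
by move=> z [Uz _]; exact: closure_dense.
Qed.

Lemma component_eq (T : topologicalType) (A C : set T) x :
  is_component A C -> C x -> C = connected_component A x.
Proof. by move=> [z Az ->]; exact: same_connected_component. Qed.

Section Embedding.
Context {E X : topologicalType}.
Variable i : E -> X.
Hypothesis emb : embedding i.

Lemma embedding_continuous : continuous i.
Proof. by apply/continuousP => V oV; apply/emb.2; exists V. Qed.

Lemma connected_preimage (O' : set X) :
  connected (O' `&` range i) -> connected (i @^-1` O').
Proof.
move=> cO B [e Be] [P oP BP] [F cF BF].
have [P' oP' PP'] := (emb.2 P).1 oP.
have [F' oF' FF'] := (emb.2 (~` F)).1 (closed_openC cF).
have iB : i @` B = O' `&` range i.
  apply: cO; first by exists (i e), e.
  - exists P' => //; rewrite BP PP'.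
    apply/seteqP; split=> [_ [a /= [Oa Pa] <-]|x [[Ox [a _ ia]] Px]].
      by split => //; split => //; exists a.
    by exists a => //=; rewrite ia.
  - exists (~` F'); first exact: open_closedC.
    have FE a : F a <-> ~ F' (i a).
      rewrite -[F' (i a)]/((i @^-1` F') a) -FF'.
      by split=> [Fa nFa|nnF]; [exact: nFa | exact: contrapT].
    rewrite BF; apply/seteqP; split=> [_ [a /= [Oa Fa] <-]|x [[Ox [a _ ia]] Fx]].
      by split; [split => //; exists a | apply/FE].
    exists a => //; split; first by rewrite /= ia.
    by apply/FE; rewrite ia.
apply/seteqP; split; first by rewrite BP => ? [].
move=> a Oa; have : (i @` B) (i a) by rewrite iB; split => //; exists a.
by move=> [c Bc /emb.1 <-].
Qed.

End Embedding.

(** * Completions of coverings of portly subsets *)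

Lemma connected_nbhs_sequence (R : realType) (Y : topologicalType) (y : Y)
    (N : set Y) :
  locally_path_connected R Y -> @second_countable Y -> nbhs y N ->
  exists U : nat -> set Y, [/\ forall n, connected_open_nbhs y (U n),
    forall n, U n.+1 `<=` U n, U 0 `<=` N &
    forall M, nbhs y M -> exists n, U n `<=` M].
Proof.
move=> lpcY Y2 yN; have [b [bo bP]] := second_countable_seq Y2.
pose sh W := xget setT [set V | connected_open_nbhs y V /\ V `<=` W].
have shP W : nbhs y W -> connected_open_nbhs y (sh W) /\ sh W `<=` W.
  move=> yW; rewrite /sh; case: xgetP => [V _ //|/= noV].
  have [V [oV VW cV]] := lpc_connected_nbhs lpcY yW.
  by case: (noV V); split.
(* Basic sets that miss [y] are replaced by the whole space, so that intersecting with them changes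
   nothing. *)
pose b' n := if pselect (b n y) is left _ then b n else setT.
have b'y n : nbhs y (b' n).
  rewrite /b'; case: pselect => [bny|_]; last exact: filterT.
  exact: open_nbhsP.
pose U := fix U n := if n is m.+1 then sh (U m `&` b' m) else sh N.
have UP n : connected_open_nbhs y (U n).
  elim: n => [|n [[oU Uy] _]]; first by have [] := shP N yN.
  by have [] := shP (U n `&` b' n) (filterI (open_nbhsP oU Uy) (b'y n)).
have US n : U n.+1 `<=` U n `&` b' n.
  have [[oU Uy] _] := UP n.
  by have [] := shP (U n `&` b' n) (filterI (open_nbhsP oU Uy) (b'y n)).
exists U; split => //.
- by move=> n x /US[].
- by have [] := shP N yN.
- move=> M /bP[n [bny bnM]]; exists n.+1 => x /US[_].
  by rewrite /b'; case: pselect => // _ /bnM.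
Qed.

Section BranchedSpread.
Context {R : realType} {E Y X : topologicalType}.
Variables (D : set Y) (f : E -> Y) (p : X -> Y) (i : E -> X).
Hypotheses (lpcE : locally_path_connected R E)
  (lpcY : locally_path_connected R Y) (lpcX : locally_path_connected R X).
Hypotheses (hY : hausdorff_space Y) (hX : hausdorff_space X).
Hypotheses (Y2 : @second_countable Y) (cY : connected [set: Y]).
Hypotheses (portlyD : portly D) (fD : covers f D) (scE : simply_connected R E).
Hypotheses (cp : complete_spread p) (emb : embedding i).
Hypotheses (pi : forall e, p (i e) = f e) (portlyi : portly (range i)).

Local Notation comp V x := (connected_component (p @^-1` V) x).

Let p_cont : continuous p. Proof. by case: cp => [[]]. Qed.
Let f_cont : continuous f. Proof. by case: fD. Qed.
Let oD : open D. Proof. by case: portlyD. Qed.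
Let Df e : D (f e). Proof. exact: (covers_in fD). Qed.
Let i_cont : continuous i. Proof. exact: embedding_continuous. Qed.
Let cE : connected [set: E].
Proof. by apply: (@path_connected_connected R); case: scE. Qed.

Lemma comp_open V x : open V -> open (comp V x).
Proof. by move=> oV; apply: (lpc_open_component lpcX); exact: open_preimage. Qed.

Lemma comp_in V x z : comp V x z -> V (p z).
Proof. by move/connected_component_sub. Qed.

Lemma comp_mono V V' x : V' `<=` V -> comp V' x `<=` comp V x.
Proof.
move=> VV z [B [Bx BV cB] Bz]; exists B => //; split => // w /BV; exact: VV.
Qed.

Lemma comp_connected_sub (V : set Y) x z (A : set X) :
  connected A -> A `<=` p @^-1` V -> A z -> comp V x z -> A `<=` comp V x.
Proof.
move=> cA AV Az xz w Aw; apply: connected_component_trans xz _.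
by exists A.
Qed.

Lemma comp_lift_connected V x : open V -> connected (i @^-1` comp V x).
Proof.
move=> oV; apply: connected_preimage => //.
by case: portlyi => _ _; apply; [exact: comp_open | exact: component_connected].
Qed.

Lemma comp_lift_open V x : open V -> open (i @^-1` comp V x).
Proof. by move=> oV; apply: open_preimage => //; exact: comp_open. Qed.

Lemma comp_meets V x : open V -> V (p x) -> exists e, comp V x (i e).
Proof.
move=> oV Vx; have [_ di _] := portlyi.
have [||z [xz [e _ ie]]] := di (comp V x).
- by exists x; exact: connected_component_refl.
- exact: comp_open.
- by exists e; rewrite ie.
Qed.

Lemma comp_along_path V x (k : R -> E) s t : continuous k ->
  (forall u, V (f (k u))) -> comp V x (i (k s)) -> comp V x (i (k t)).
Proof.
move=> ck kV xs; have cik : connected ((i \o k) @` setT).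
  by apply: connected_imageT connectedRT _; exact: continuous_fun_comp ck i_cont.
apply: (comp_connected_sub cik _ _ xs); last by exists t.
- by move=> _ [u _ <-]; rewrite /= pi.
- by exists s.
Qed.

Lemma comp_path_in V x e e' : open V -> comp V x (i e) -> comp V x (i e') ->
  @path_in R E (i @^-1` comp V x) e e'.
Proof.
by move=> oV xe xe'; apply: lpc_path_in => //;
  [exact: comp_lift_open | exact: comp_lift_connected].
Qed.

(** Over an evenly covered [U], the trace on [E] of the component of [x] lies in one sheet with
    section [g]. On that trace [i (g (p z)) = z]; by density and the Hausdorff property this
    persists at [x]. *)
Lemma preimage_regular x : D (p x) -> exists e, x = i e.
Proof.
move=> Dx; have [_ _ /(_ _ Dx)[U [V [Ux _ ev]]]] := fD.
have [oU _ _ sh] := ev.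
have [e1 xe1] := comp_meets oU Ux.
have Uf e : comp U x (i e) -> U (f e) by move/comp_in; rewrite pi.
have [W VW We1] := sheet_at ev (Uf _ xe1).
have AW : forall e, comp U x (i e) -> W e.
  have cid : continuous (id : E -> E) by move=> ?; exact: cvg_id.
  exact: (lift_in_sheet ev VW (comp_lift_connected (x := x) oU) cid Uf xe1 We1).
have [oW _ [g [gW fg gK cg]]] := sh _ VW.
exists (g (p x)); apply: hX => N1 N2 xN1 xN2.
have iN2 : nbhs (g (p x)) (i @^-1` N2) by exact: i_cont.
have N2' : nbhs x (p @^-1` (g @^-1` (i @^-1` N2))).
  by apply: p_cont; apply: (nbhs_preimage (cg _ Ux) iN2).
have [_ di _] := portlyi.
have [||z [/interior_subset[[N1z N2z] xz] [e _ ie]]] :=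
    di (N1 `&` (p @^-1` (g @^-1` (i @^-1` N2))) `&` comp U x)°.
- exists x; apply: filterI; first exact: filterI.
  by apply: open_nbhsP; [exact: comp_open | exact: connected_component_refl].
- exact: open_interior.
- exists z; split => //; move: N2z; rewrite /preimage /= -ie pi gK//.
  by apply: AW; rewrite ie.
Qed.

(** Since [D] is locally connected in [Y], the trace of [V] on [D] is connected, and being hit by
    the component propagates along sections of sheets. *)
Lemma comp_onto_regular V x d : open V -> connected V -> V (p x) -> V d -> D d ->
  exists e, comp V x (i e) /\ f e = d.
Proof.
move=> oV cV Vx Vd Dd.
have [_ _ lcD] := portlyD.
have [e1 xe1] := comp_meets oV Vx.
have Vf e : comp V x (i e) -> V (f e) by move/comp_in; rewrite pi.
suff : V `&` D `<=` [set d | exists e, comp V x (i e) /\ f e = d] by apply.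
apply: (connected_propagation (lcD V oV cV) (x0 := f e1)).
- by split => //; exact: Vf.
- by exists e1.
move=> z [Vz Dz]; have [_ _ /(_ _ Dz)[U [F [Uz _ ev]]]] := fD.
have [oU _ _ sh] := ev.
have [N [[oN Nz] NUV cN]] :=
  lpc_connected_nbhs lpcY (filterI (open_nbhsP oU Uz) (open_nbhsP oV Vz)).
exists N; first exact: open_nbhsP.
move=> a b _ Na [e [xe fe]] _ Nb.
have [W FW We] : exists2 W, F W & W e.
  by apply: (sheet_at ev); rewrite fe; have [] := NUV _ Na.
have [oW _ [g [gW fg gK cg]]] := sh _ FW.
exists (g b); split; last by apply: fg; have [] := NUV _ Nb.
have cig : connected ((i \o g) @` N).
  apply: connected_continuous_connected => //.
  apply: continuous_in_subspaceT => u; rewrite inE => Nu.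
  apply: continuous_comp; last exact: i_cont.
  by apply: cg; have [] := NUV _ Nu.
apply: (comp_connected_sub cig _ _ xe).
- by move=> _ [u Nu <-]; have [Uu Vu] := NUV _ Nu; rewrite /= pi fg.
- by exists a => //=; rewrite -fe gK.
- by exists b.
Qed.

(** By density [V'] contains a regular point; [K] has a point over it, whose component over [V']
    stays in [K]. *)
Lemma subcomponent V V' y K :
  connected_open_nbhs y V -> connected_open_nbhs y V' ->
  V' `<=` V -> is_component (p @^-1` V) K ->
  exists2 K', is_component (p @^-1` V') K' & K' `<=` K.
Proof.
move=> [[oV Vy] cV] [[oV' V'y] cV'] VV [x Vx ->].
have [_ dD _] := portlyD.
have [||d [V'd Dd]] := dD V'; [by exists y | by [] |].
have [e [xe fe]] := comp_onto_regular oV cV Vx (VV _ V'd) Dd.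
exists (comp V' (i e)); first by exists (i e) => //; rewrite /= pi fe.
by move=> z /(comp_mono VV); apply: connected_component_trans.
Qed.

Lemma closure_range_spread y : closure (range p) y.
Proof.
move=> N Ny; have [_ dD _] := portlyD.
have [||d [/interior_subset Nd Dd]] := dD N°.
- by exists y; exact: Ny.
- exact: open_interior.
have [_ fr _] := fD; move: (Dd); rewrite -fr => -[e _ fe].
by exists d; split => //; exists (i e) => //; rewrite pi.
Qed.

Lemma limit_in_fiber y z :
  (forall V, connected_open_nbhs y V -> V (p z)) -> p z = y.
Proof.
move=> zV; apply/esym/hY => A B yA zB.
have [V [[oV Vy] VA cV]] := lpc_connected_nbhs lpcY yA.
exists (p z); split; last exact: nbhs_singleton.
by apply: VA; apply: zV.
Qed.

(** Completeness wants a component over every connected neighborhood. A nested sequence over a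
    neighborhood basis determines them all: over [V], take the component that contains some
    [C n]. *)
Lemma complete_sequence y (U : nat -> set Y) (C : nat -> set X) :
  (forall n, connected_open_nbhs y (U n)) -> (forall n, U n.+1 `<=` U n) ->
  (forall M, nbhs y M -> exists n, U n `<=` M) ->
  (forall n, is_component (p @^-1` U n) (C n)) -> (forall n, C n.+1 `<=` C n) ->
  exists x, p x = y /\ forall n, C n x.
Proof.
move=> UP US UB CP CS.
have C0 n : exists z, C n z.
  by have [z Uz ->] := CP n; exists z; exact: connected_component_refl.
have CU n z : C n z -> U n (p z).
  by have [w _ ->] := CP n => /comp_in.
pose good V K := is_component (p @^-1` V) K /\ exists n, C n `<=` K.
pose chi V := xget set0 (good V).
have /choice[zs zsC] := C0.
have zsU n : U n (p (zs n)) by exact: CU.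
have goodn V n : U n `<=` V -> good V (comp V (zs n)).
  move=> UV; split; first by exists (zs n) => //; exact: UV.
  by exists n; rewrite (component_eq (CP n) (zsC n)); exact: comp_mono.
have chiP V : connected_open_nbhs y V -> good V (chi V).
  move=> [[oV Vy] cV]; have [n UnV] := UB V (open_nbhsP oV Vy).
  exact: (xgetPex _ (ex_intro _ _ (goodn V n UnV))).
have good_common V V' K K' : good V K -> good V' K' -> exists2 z, K z & K' z.
  move=> [_ [n nK]] [_ [m mK']]; exists (zs (maxn n m)).
    by apply: nK; apply: (decreasing_sets CS (leq_maxl n m)).
  by apply: mK'; apply: (decreasing_sets CS (leq_maxr n m)).
have chi_mono V V' : connected_open_nbhs y V -> connected_open_nbhs y V' ->
    V `<=` V' -> chi V `<=` chi V'.
  move=> /chiP gV /chiP gV' VV'; have [z Vz V'z] := good_common _ _ _ _ gV gV'.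
  rewrite (component_eq gV.1 Vz) (component_eq gV'.1 V'z); exact: comp_mono.
have [_ complete] := cp.
have [||x xchi] := complete y (@closure_range_spread y) chi.
- by move=> V /chiP[].
- exact: chi_mono.
exists x; split.
  apply: limit_in_fiber => V yV; have := xchi V yV.
  by have [[w _ ->] _] := chiP V yV => /comp_in.
move=> n; have := xchi _ (UP n).
have gU := chiP _ (UP n).
have [z Uz Uz'] := good_common _ _ _ _ gU (goodn (U n) n (fun _ h => h)).
rewrite (component_eq gU.1 Uz) (component_eq (CP n) (zsC n)).
by rewrite (same_connected_component Uz').
Qed.

(** Components are chosen successively inside [K] over a shrinking sequence of neighborhoods;
    completeness provides a common point. *)
Lemma component_meets_fiber V y K : connected_open_nbhs y V ->
  is_component (p @^-1` V) K -> exists x, K x /\ p x = y.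
Proof.
move=> [[oV Vy] cV] KV.
have [U [UP US UV UB]] := connected_nbhs_sequence lpcY Y2 (open_nbhsP oV Vy).
have sub := @subcomponent _ _ y.
have [K0 K0P K0K] := sub _ _ K (conj (conj oV Vy) cV) (UP 0) UV KV.
pose next n C := xget set0 [set C' | is_component (p @^-1` U n) C' /\ C' `<=` C].
pose C := fix C n := if n is m.+1 then next m.+1 (C m) else K0.
have CP n : is_component (p @^-1` U n) (C n).
  elim: n => [//|n IH] /=; rewrite /next; case: xgetP => [C' _ []//|noC].
  by have [C' C'P C'C] := sub _ _ _ (UP n) (UP n.+1) (US n) IH; case: (noC C').
have CS n : C n.+1 `<=` C n.
  rewrite /= /next; case: xgetP => [C' _ []//|noC].
  by have [C' C'P C'C] := sub _ _ _ (UP n) (UP n.+1) (US n) (CP n); case: (noC C').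
have [x [px Cx]] := complete_sequence UP US UB CP CS.
by exists x; split => //; exact/K0K/(Cx 0).
Qed.

Lemma spread_surjective : range p = [set: Y].
Proof.
apply/seteqP; split => // y _.
have [V [[oV Vy] _ cV]] := lpc_connected_nbhs lpcY (filterT : nbhs y setT).
have [_ [[x _ <-] Vx]] := closure_range_spread (open_nbhsP oV Vy).
have [||z [_ pz]] := @component_meets_fiber V y (comp V x).
- by split.
- by exists x.
by exists z.
Qed.

Lemma component_nbhs x N : nbhs x N ->
  exists2 V, connected_open_nbhs (p x) V & comp V x `<=` N.
Proof.
move=> xN; have [[_ gen] _] := cp.
have [D' D'G NE] := (gen N°).1 (open_interior N).
have : N° x by exact: xN.
rewrite NE => -[B D'B Bx].
(* As [F] is a filter, the finite intersections of the generated topology reduce to single subbasic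
   components. *)
pose F := filter_from (connected_open_nbhs (p x)) (fun V => comp V x).
have FF : Filter F.
  apply: filter_from_filter.
    have [V [oV _ cV]] := lpc_connected_nbhs lpcY (filterT : nbhs (p x) setT).
    by exists V.
  move=> V1 V2 [[oV1 V1x] _] [[oV2 V2x] _].
  have [V [oV VV cV]] := lpc_connected_nbhs lpcY
    (filterI (open_nbhsP oV1 V1x) (open_nbhsP oV2 V2x)).
  exists V => // z xz; split; apply: comp_mono xz => w /VV[] //.
suff [V xV VB] : F B.
  by exists V => // z /VB Bz; apply: interior_subset; rewrite NE; exists B.
have [G GG GB] := D'G B D'B; rewrite -GB.
apply: filter_bigI => C CG; have [U oU CU] : [set C | exists2 U : set Y,
    open U & is_component (p @^-1` U) C] C by apply: set_mem; exact: GG.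
have Cx : C x by move: Bx; rewrite -GB; apply.
rewrite (component_eq CU Cx).
have Ux : U (p x) by have := Cx; rewrite (component_eq CU Cx) => /comp_in.
have [V [oV VU cV]] := lpc_connected_nbhs lpcY (open_nbhsP oU Ux).
by exists V; [split | exact: comp_mono].
Qed.

Lemma fiber_separated x x' : p x = p x' ->
  (forall V, connected_open_nbhs (p x) V -> comp V x x') -> x = x'.
Proof.
move=> pxx' xVx'; apply: hX => N N' /component_nbhs[V [[oV Vx] _] VN].
move=> /component_nbhs[V' [[oV' V'x] _] VN']; rewrite -pxx' in V'x.
have [W [[oW Wx] WV cW]] := lpc_connected_nbhs lpcY
    (filterI (open_nbhsP oV Vx) (open_nbhsP oV' V'x)).
have xW : comp W x x' by apply: xVx'; split.
exists x'; split; first by apply/VN/comp_mono/xW => w /WV[].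
apply: VN'; apply: connected_component_refl; rewrite /= -pxx'.
exact: V'x.
Qed.

(** Over a connected open set inside an evenly covered one, a component consists of points of [E]
    lying in a single sheet, whose section inverts [p]. *)
Lemma regular_sub_OrdY : D `<=` OrdY p.
Proof.
move=> y Dy; have [_ _ /(_ _ Dy)[U [F [Uy UD ev]]]] := fD.
have [oU _ _ sh] := ev.
have [V [[oV Vy] VU cV]] := lpc_connected_nbhs lpcY (open_nbhsP oU Uy).
exists V => // _ [x Vx ->].
have [e xe] : exists e, x = i e by apply/preimage_regular/UD/VU.
have Vf e' : comp V x (i e') -> V (f e') by move/comp_in; rewrite pi.
have [W FW We] : exists2 W, F W & W e.
  by apply: (sheet_at ev); apply: VU; rewrite -pi -xe.
have [oW _ [g [gW fg gK cg]]] := sh _ FW.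
have xx : comp V x (i e) by rewrite -xe; exact: connected_component_refl.
have cid : continuous (id : E -> E) by move=> ?; exact: cvg_id.
have AW := lift_in_sheet ev FW (comp_lift_connected (x := x) oV) cid
    (fun z xz => VU _ (Vf z xz)) xx We.
have cig : {within V, continuous (i \o g)}.
  apply: continuous_in_subspaceT => u; rewrite inE => Vu.
  by apply: continuous_comp; [apply/cg/VU | exact: i_cont].
have cigV := connected_continuous_connected cV cig.
have lift_of z : comp V x z -> exists e', [/\ z = i e', W e' & V (f e')].
  move=> xz; have Vz := comp_in xz.
  have [e' ze'] : exists e', z = i e' by apply/preimage_regular/UD/VU.
  by exists e'; split => //; [apply: AW | apply: Vf]; rewrite /= -ze'.
have gx u : V u -> comp V x (i (g u)).
  move=> Vu; apply: (comp_connected_sub cigV _ _ xx); last by exists u.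
  - by move=> _ [v Vv <-]; rewrite /= pi fg//; exact: VU.
  - by exists (f e); [rewrite -pi -xe | rewrite /= gK].
split; first exact: continuous_subspaceT.
- split.
  + by move=> z /comp_in.
  + move=> a b; rewrite !inE => /lift_of[a' [-> Wa _]] /lift_of[b' [-> Wb _]].
    by rewrite !pi => fab; congr i; exact: (sheet_inj (sh _ FW)).
  + by move=> u Vu; exists (i (g u)); [exact: gx | rewrite pi fg//; exact: VU].
- exists (i \o g) => // z; rewrite inE => /lift_of[e' [-> We' _]].
  by rewrite /= pi gK.
Qed.

Lemma branched_covering_completion : branched_covering p.
Proof.
have oO : open (OrdY p).
  apply: openP => y [U [oU Uy] UC].
  apply: filterS (open_nbhsP oU Uy) => z Uz; exists U => //.
split => //.
- exact: spread_surjective.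
- split=> //; have [_ di _] := portlyi.
  apply: (connected_between (connected_imageT cE i_cont)) => // x _.
  by move=> N Nx; have := closure_dense di openT (I : setT x) Nx; rewrite setTI.
- apply: portly_sup portlyi _ _; first exact: open_preimage.
  by move=> _ [e _ <-]; rewrite /OrdX /= pi; exact: regular_sub_OrdY.
- exact: portly_sup portlyD oO regular_sub_OrdY.
Qed.

(** * Automorphisms of the completion *)

Lemma deck_extends (g : E -> E) : continuous g -> (forall e, f (g e) = f e) ->
  exists phi : X -> X, [/\ continuous phi, forall x, p (phi x) = p x &
    forall e, phi (i e) = i (g e)].
Proof.
move=> cg fg; have [_ complete] := cp.
(* The trace of a component on [E] is connected, so [g] sends it into one component. Hence the
   components [chi V] below do not depend on the points [pick V] and form a coherent system, whose
   common point is the value at [x]. *)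
have gsame V x e e' : open V -> comp V x (i e) -> comp V x (i e') ->
    comp V (i (g e)) (i (g e')).
  move=> oV xe xe'.
  have cig : connected ((i \o g) @` (i @^-1` comp V x)).
    apply: connected_imageT; first exact: comp_lift_connected.
    exact: continuous_fun_comp cg i_cont.
  exists ((i \o g) @` (i @^-1` comp V x)); last by exists e'.
  split => //; first by exists e.
  by move=> _ [a xa <-]; rewrite /= pi fg -pi; exact: comp_in xa.
have /choice[phi phiP] x : exists z, p z = p x /\ forall V e,
    connected_open_nbhs (p x) V -> comp V x (i e) -> comp V z (i (g e)).
  have [e0 _] : exists e0 : E, True.
    by have [[e0 _] _ _] := scE; exists e0.
  pose pick V := xget e0 [set e | comp V x (i e)].
  have pickP V : connected_open_nbhs (p x) V -> comp V x (i (pick V)).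
    move=> [[oV Vx] cV]; have [e xe] := comp_meets oV Vx.
    by rewrite /pick; case: xgetP => [a _ //|/(_ e)].
  pose chi V := comp V (i (g (pick V))).
  have Vg V : connected_open_nbhs (p x) V -> V (p (i (g (pick V)))).
    by move=> /pickP/comp_in; rewrite !pi fg.
  have [||z zchi] := complete (p x) (@closure_range_spread _) chi.
  - by move=> V xV; exists (i (g (pick V))) => //; exact: Vg.
  - move=> V V' xV xV' VV' w; rewrite /chi => /(comp_mono VV').
    apply: connected_component_trans; have [[oV' _] _] := xV'.
    by apply: (gsame _ x) => //; [exact: pickP | apply: comp_mono (pickP _ xV)].
  exists z; split.
    by apply: limit_in_fiber => V xV; exact: comp_in (zchi V xV).
  move=> V e xV xe; have /connected_component_sym zg := zchi V xV.
  apply: connected_component_trans zg _; have [[oV _] _] := xV.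
  by apply: (gsame _ x) => //; exact: pickP.
exists phi; split; last 2 first.
- by move=> x; have [] := phiP x.
- move=> e; have [pe eP] := phiP (i e).
  apply: fiber_separated; first by rewrite pe !pi fg.
  rewrite pe => V xV; apply: eP => //; apply: connected_component_refl.
  by have [[_]] := xV.
move=> x; apply: continuous_atI => N /component_nbhs[V].
have [px xP] := phiP x; rewrite px => xV VN; have [[oV Vx] cV] := xV.
have xx : comp V x x by exact: connected_component_refl.
have := open_nbhsP (@comp_open V x oV) xx.
apply: filterS => x' xx'; apply: VN.
have [e xe] := comp_meets oV Vx.
have [px' x'P] := phiP x'.
apply: connected_component_trans (xP V e xV xe) _.
apply: connected_component_sym; apply: x'P.
  by split=> //; split => //; exact: comp_in xx'.
by rewrite -(same_connected_component xx').
Qed.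

(** Deck transformations from [e] to [e'] and back are mutually inverse by uniqueness of lifts;
    density of the image of [i] carries this over to their extensions. *)
Lemma Gamma_regular_transitive e e' : f e = f e' ->
  exists2 phi, Gamma p phi & phi (i e) = i e'.
Proof.
move=> fee'.
have [g [cg fg ge]] := deck_transformation scE lpcE fD fee'.
have [g' [cg' fg' ge']] := deck_transformation scE lpcE fD (esym fee').
have [phi [cphi pphi phii]] := deck_extends cg fg.
have [psi [cpsi ppsi psii]] := deck_extends cg' fg'.
have [_ di _] := portlyi.
have cid : continuous (id : X -> X) by move=> ?; exact: cvg_id.
have cidE : continuous (id : E -> E) by move=> ?; exact: cvg_id.
have gg' a : g' (g a) = a.
  apply: (@lift_unique _ _ _ _ fD _ setT (fun a => g' (g a)) id e) => //.
  - exact: continuous_fun_comp.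
  - by move=> z _; rewrite fg' fg.
  - by rewrite ge.
have g'g a : g (g' a) = a.
  apply: (@lift_unique _ _ _ _ fD _ setT (fun a => g (g' a)) id e') => //.
  - exact: continuous_fun_comp.
  - by move=> z _; rewrite fg fg'.
  - by rewrite ge'.
exists phi; last by rewrite phii ge.
split => //; last exact/funext.
exists psi; split => // x.
- have := eq_on_dense hX di (continuous_fun_comp cphi cpsi) cid.
  by move=> /(_ _)/(congr1 (@^~ x)); apply => _ [a _ <-]; rewrite phii psii gg'.
- have := eq_on_dense hX di (continuous_fun_comp cpsi cphi) cid.
  by move=> /(_ _)/(congr1 (@^~ x)); apply => _ [a _ <-]; rewrite psii phii g'g.
Qed.

(** The image of [i] is the full preimage of [D], which every automorphism preserves. *)
Lemma Gamma_restricts phi : Gamma p phi ->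
  exists k : E -> E, [/\ continuous k, forall e, f (k e) = f e &
    forall e, phi (i e) = i (k e)].
Proof.
move=> [cphi _ pphi].
have pphi' x : p (phi x) = p x by rewrite -[in RHS]pphi.
have /choice[k kP] e : exists a, phi (i e) = i a.
  by apply: preimage_regular; rewrite pphi' pi.
exists k; split => //.
- apply/continuousP => A /emb.2[V oV ->].
  rewrite (_ : k @^-1` _ = (fun e => phi (i e)) @^-1` V).
    by apply: open_preimage => //; exact: continuous_fun_comp.
  by apply/seteqP; split => e /=; rewrite /preimage /= kP.
- by move=> e; rewrite -pi -kP pphi' pi.
Qed.

(** Uniqueness of lifts on [E], then density in [X]. Evaluation at a regular point thus embeds the
    group in a countable fiber. *)
Lemma Gamma_rigid phi psi e : Gamma p phi -> Gamma p psi ->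
  phi (i e) = psi (i e) -> phi = psi.
Proof.
move=> Gphi Gpsi phipsi.
have [k [ck fk phik]] := Gamma_restricts Gphi.
have [l [cl fl psil]] := Gamma_restricts Gpsi.
have [_ di _] := portlyi; have [cphi _ _] := Gphi; have [cpsi _ _] := Gpsi.
apply: (eq_on_dense hX di cphi cpsi) => _ [a _ <-].
rewrite phik psil; congr i.
apply: (@lift_unique _ _ _ _ fD _ setT k l e) => //.
- by move=> z _; rewrite fk fl.
- by apply: emb.1; rewrite -phik -psil.
Qed.

(** * Discreteness of fibers and transitivity on them *)

Lemma discrete_fibersP : has_discrete_fibers p <-> forall x,
  exists2 V, connected_open_nbhs (p x) V &
    forall x', comp V x x' -> p x' = p x -> x' = x.
Proof.
split=> [disc x|loc y A].
  pose F := p @^-1` [set p x].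
  have Fx : F x by [].
  have [W oW WE] : exists2 W : set X, open W &
      set_val @^-1` W = [set (SigSub (mem_set Fx) : set_type F)].
    exact: (disc (p x) [set SigSub (mem_set Fx)]).
  have Wx : W x.
    have : (set_val @^-1` W) (SigSub (mem_set Fx) : set_type F) by rewrite WE.
    by [].
  have [V xV VW] := component_nbhs (open_nbhsP oW Wx).
  exists V => // x' xx' px'; have Fx' : F x' by [].
  have : (set_val @^-1` W) (SigSub (mem_set Fx') : set_type F).
    exact: VW xx'.
  by rewrite WE => /(congr1 val).
apply: openP => a Aa.
have [V [[oV Vx] cV] Va] := loc (set_val a).
exists (set_val @^-1` comp V (set_val a)); split.
- by exists (comp V (set_val a)) => //; exact: comp_open.
- exact: connected_component_refl.
- move=> b /= ab; suff -> : b = a by [].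
  apply: val_inj; apply: Va => //.
  by rewrite (set_valP b) (set_valP a).
Qed.

Lemma discrete_Galoisian : has_discrete_fibers p -> Galoisian p.
Proof.
move=> /discrete_fibersP loc; split; first exact: branched_covering_completion.
move=> x x' pxx'; have [V1 [[oV1 V1x] _] V1x1] := loc x.
have [V2 [[oV2 V2x] _] V2x2] := loc x'.
rewrite -pxx' in V2x V2x2.
have [V [[oV Vx] VV cV]] := lpc_connected_nbhs lpcY
  (filterI (open_nbhsP oV1 V1x) (open_nbhsP oV2 V2x)).
have [e xe] := comp_meets oV Vx.
have [e' [x'e' fee']] : exists e', comp V x' (i e') /\ f e' = f e.
  apply: comp_onto_regular => //; first by rewrite -pxx'.
  by rewrite -pi; exact: comp_in xe.
have [phi Gphi phie] := Gamma_regular_transitive (esym fee').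
exists phi => //; have [cphi _ pphi] := Gphi.
have pphi' z : p (phi z) = p z by rewrite -[in RHS]pphi.
(* It suffices that [phi x] lies in the component of [x'] over [V2], where [x'] is the only point of
   the fiber. The component of [x] over [V] is moved there together with [i e]. *)
apply: V2x2; last by rewrite pphi'.
apply: (comp_mono (V' := V)); first by move=> w /VV[].
have cphiV : connected (phi @` comp V x).
  by apply: connected_imageT cphi; exact: component_connected.
apply: (comp_connected_sub cphiV _ _ x'e').
- by move=> _ [w xw <-]; rewrite /= pphi'; exact: comp_in xw.
- by exists (i e).
- by exists x => //; exact: connected_component_refl.
Qed.

(* Baire category argument: a fiber is the orbit of one of its points under a
   countable group, so if no point were isolated a nested sequence of components
   would avoid all of them one after the other. *)
Lemma Galoisian_discrete : Galoisian p -> has_discrete_fibers p.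
Proof.
move=> [_ trans]; apply/discrete_fibersP => x; apply: contrapT => noV.
set y := p x in noV *.
have notisolated V : connected_open_nbhs y V ->
    exists x', [/\ comp V x x', p x' = y & x' <> x].
  move=> yV; apply: contrapT => nox'; apply: noV; exists V => // x' xx' px'.
  by apply: contrapT => nx'; apply: nox'; exists x'.
(* Homogeneity carries the non-isolation of [x] to every point of the fiber, so no component reduces
   to the single fiber point [w]. *)
have avoid V K w : connected_open_nbhs y V -> is_component (p @^-1` V) K ->
    p w = y -> exists z, [/\ K z, p z = y & z <> w].
  move=> yV KV pw; have [z [Kz pz]] := component_meets_fiber yV KV.
  have [zw|] := pselect (z = w); last by exists z.
  have [phi [cphi [psi [_ phiK _]] pphi] phix] := trans x z (esym pz).
  have pphi' a : p (phi a) = p a by rewrite -[in RHS]pphi.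
  have [x' [xx' px' x'x]] := notisolated V yV.
  exists (phi x'); split; last 2 first.
  - by rewrite pphi'.
  - by rewrite -zw -phix => /(can_inj phiK).
  rewrite (component_eq KV Kz).
  have cphiV : connected (phi @` comp V x).
    by apply: connected_imageT cphi; exact: component_connected.
  have [[oV Vy] cV] := yV.
  apply: (comp_connected_sub cphiV _ (z := z)).
  - by move=> _ [a xa <-]; rewrite /= pphi'; exact: comp_in xa.
  - by exists x => //; exact: connected_component_refl.
  - by apply: connected_component_refl; rewrite /= pz.
  - by exists x'.
have [[e0 _] _ _] := scE.
have [j jP] := countable_fiber fD Y2 cE e0.
(* Enumeration of the fiber: by rigidity an automorphism is coded by its value at [i e0], and its
   value at [x] is listed. The default [x] also lies in the fiber. *)
pose w n : X := if unpickle n is Some s then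
  xget x [set z | p z = y /\
    exists2 phi, Gamma p phi & phi (i e0) = i (j s) /\ z = phi x]
  else x.
have wfib n : p (w n) = y.
  by rewrite /w; case: unpickle => // s; case: xgetP => [z _ []|].
have wall z : p z = y -> exists n, z = w n.
  move=> pz; have [phi Gphi phix] := trans x z (esym pz).
  have [k [ck fk phik]] := Gamma_restricts Gphi.
  have [s ks] := jP (k e0) (fk e0).
  exists (pickle s); rewrite /w pickleK.
  case: xgetP => [z' _ [_ [psi Gpsi [psi0 ->]]]|/(_ z)[]].
    by rewrite -phix (Gamma_rigid (e := e0) Gphi Gpsi)// psi0 phik ks.
  by split => //; exists phi => //; rewrite phik ks.
have [U [UP US _ UB]] := connected_nbhs_sequence (y := y) lpcY Y2 filterT.
(* The [n]-th step excludes [w n], and the inclusion in [U n] makes the neighborhoods shrink to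
   [y]. *)
pose good n (VK VK' : set Y * set X) := [/\ connected_open_nbhs y VK'.1,
  is_component (p @^-1` VK'.1) VK'.2, VK'.1 `<=` VK.1 `&` U n, VK'.2 `<=` VK.2 &
  ~ VK'.2 (w n)].
have step n VK : connected_open_nbhs y VK.1 -> is_component (p @^-1` VK.1) VK.2 ->
    exists VK', good n VK VK'.
  case: VK => V K /= yV KV; have [z [Kz pz zw]] := avoid V K (w n) yV KV (wfib n).
  have [V0 yV0 V0w] : exists2 V0, connected_open_nbhs y V0 & ~ comp V0 z (w n).
    apply: contrapT => noV0; apply: zw; apply: fiber_separated.
      by rewrite pz wfib.
    by rewrite pz => V0 yV0; apply: contrapT => ?; apply: noV0; exists V0.
  have [[oV Vy] _] := yV; have [[oV0 V0y] _] := yV0; have [[oU Uy] _] := UP n.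
  have [V' [[oV' V'y] VV' cV']] := lpc_connected_nbhs lpcY
    (filterI (filterI (open_nbhsP oV Vy) (open_nbhsP oU Uy)) (open_nbhsP oV0 V0y)).
  exists (V', comp V' z); split => //=.
  - by exists z => //; rewrite /= pz.
  - by move=> a /VV'[].
  - by rewrite (component_eq KV Kz); apply: comp_mono => a /VV'[[]].
  - by move=> V'w; apply: V0w; apply: comp_mono V'w => a /VV'[].
pose S := fix S n := if n is m.+1 then xget (U 0, comp (U 0) x) (good m (S m))
  else (U 0, comp (U 0) x).
have S01 n : connected_open_nbhs y (S n).1 /\ is_component (p @^-1` (S n).1) (S n).2.
  elim: n => [|n [Sn1 Sn2]] /=.
    by split => //; exists x => //; have [[_]] := UP 0.
  by case: xgetP => [VK _ []|noVK] //; have [VK] := step n _ Sn1 Sn2; move/noVK.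
have Sgood n : good n (S n) (S n.+1).
  have [Sn1 Sn2] := S01 n.
  exact: (xgetPex _ (step n _ Sn1 Sn2)).
have [|||||z [pz zS]] := @complete_sequence y (fun n => (S n).1) (fun n => (S n).2).
- by move=> n; have [] := S01 n.
- by move=> n; have [_ _ SS _ _] := Sgood n => a /SS[].
- move=> M /UB[n UM]; exists n.+1; have [_ _ SS _ _] := Sgood n.
  by move=> a /SS[_ /UM].
- by move=> n; have [] := S01 n.
- by move=> n; have [_ _ _ SS _] := Sgood n.
have [n zw] := wall z pz; have [_ _ _ _] := Sgood n.
by apply; rewrite -zw; exact: zS.
Qed.

(** * Small loops and discrete fibers *)

(** With [V] isolating a point [x] over [y], the middle part of a loop is lifted to [E]. Both ends
    of the lift lie in the component of [x] over the small set [W], so the lift is homotopic in [E]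
    to a path inside that component. *)
Lemma discrete_slsc_in : has_discrete_fibers p ->
  semi_locally_simply_connected_in R D.
Proof.
move=> /discrete_fibersP loc; split; first by case: portlyD.
have [_ _ lcD] := portlyD.
move=> y; have : range p y by rewrite spread_surjective.
move=> [x _ px]; have [V xV Vx] := loc x; rewrite px in xV Vx.
exists V => // g [[cg g0 g1] gV] N [oN Ny].
have [[oV Vy] cV] := xV.
have [W [[oW Wy] WVN cW]] := lpc_connected_nbhs lpcY
  (filterI (open_nbhsP oV Vy) (open_nbhsP oN Ny)).
have WV : W `<=` V by move=> w /WVN[].
have WN : W `<=` N by move=> w /WVN[].
pose gc (t : R) := g (clamp t).
have cgc : continuous gc by exact: clamp_path_continuous.
have [d [d0 d2 gd0 gd1]] : exists d : R, [/\ 0 < d, d < 2^-1,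
    forall t, t <= d -> W (gc t) & forall t, 1 - d <= t -> W (gc t)].
  have nW : nbhs y W by exact: open_nbhsP.
  have /nbhs_ballP[a /= a0 aW] : nbhs (0 : R) (gc @^-1` W).
    by apply: cgc; rewrite /gc clamp0 g0.
  have /nbhs_ballP[b /= b0 bW] : nbhs (1 : R) (gc @^-1` W).
    by apply: cgc; rewrite /gc clamp1 g1.
  exists (Num.min (Num.min a b) 2^-1 / 2).
  have m0 : 0 < Num.min (Num.min a b) 2^-1 by rewrite !lt_min a0 b0 invr_gt0 ltr0n.
  have ma : Num.min (Num.min a b) 2^-1 <= a by rewrite !ge_min lexx.
  have mb : Num.min (Num.min a b) 2^-1 <= b by rewrite !ge_min lexx orbT.
  have m2 : Num.min (Num.min a b) 2^-1 <= 2^-1 by rewrite !ge_min lexx orbT.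
  move: (Num.min _ _) m0 ma mb m2 => m m0 ma mb m2; split; [lra|lra| |].
  - move=> t tm; have [t0|t0] := leP t 0.
      by rewrite /gc clamp_le0// g0.
    by apply: aW; rewrite /ball /= sub0r normrN gtr0_norm//; lra.
  - move=> t tm; have [t0|t0] := leP 1 t.
      by rewrite /gc clamp_ge1// g1.
    by apply: bW; rewrite /ball /= gtr0_norm; lra.
have gVD t : 0 < t -> t < 1 -> V (gc t) /\ D (gc t).
  by move=> t0 t1; rewrite /gc clamp_id ?in_itv /= ?ltW//; apply: gV;
    rewrite in_itv /= t0 t1.
pose aff := shrink d.
have caff : continuous aff by exact: shrink_continuous.
have aff_in t : d <= aff t /\ aff t <= 1 - d by apply: shrink_bounds; exact: ltW.
pose sg t := gc (aff t).
have csg : continuous sg by exact: continuous_fun_comp caff cgc.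
have sgVD t : V (sg t) /\ D (sg t) by apply: gVD; have := aff_in t; lra.
have sg0 : sg 0 = gc d by rewrite /sg /aff shrink0.
have sg1 : sg 1 = gc (1 - d) by rewrite /sg /aff shrink1.
have sgc t : sg (clamp t) = sg t by rewrite /sg /aff shrink_clamp.
have Wp : W (p x) by rewrite px.
have [ea [xea fea]] : exists e, comp W x (i e) /\ f e = sg 0.
  by apply: comp_onto_regular => //; [rewrite sg0; exact: gd0 | case: (sgVD 0)].
have [k [ck k0 fk]] := @path_lift _ _ R _ _ fD sg ea csg (fun t => (sgVD t).2) fea.
have {}fk t : f (k t) = sg t by rewrite fk sgc.
have kV t : comp V x (i (k t)).
  apply: (@comp_along_path V x k 0 t ck) => [u|].
    by rewrite fk; case: (sgVD u).
  by rewrite k0; exact: comp_mono xea.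
have yW : connected_open_nbhs y W by [].
have Wb : W (f (k 1)) by rewrite fk sg1; exact: gd1.
(* The component over [W] at the end of the lift meets the fiber of [y]; the point found lies in
   [comp V x], hence is [x]. *)
have xb : comp W x (i (k 1)).
  have [|x' [bx' px']] := @component_meets_fiber W y (comp W (i (k 1))) yW.
    by exists (i (k 1)) => //; rewrite /= pi.
  have x'x : x' = x.
    apply: Vx => //; apply: connected_component_trans (kV 1) _.
    exact: comp_mono bx'.
  by apply: connected_component_sym; rewrite -x'x.
have [m [cm m0 m1 mW]] := comp_path_in oW xea xb.
have [K [cK K0 K1 Ks Kc]] := simply_connected_paths scE ck cm k0 m0 erefl m1.
have fmW t : W (f (m t)) by have := comp_in (mW t); rewrite pi.
have d12 : 1 - 2 * d != 0 by rewrite gt_eqF//; lra.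
(* Inverse of [aff] on the interval from [d] to [1 - d]. *)
pose tau (t : R) := (t - d) / (1 - 2 * d).
have ctau : continuous tau.
  move=> t; apply: cvgMl; apply: cvgB; [exact: cvg_id | exact: cvg_cst].
have affK t : d <= t -> t <= 1 - d -> aff (tau t) = t.
  move=> dt td; rewrite /aff /shrink clamp_id; last first.
    rewrite in_itv /= /tau divr_ge0; [|lra|lra].
    by rewrite ler_pdivrMr; lra.
  by rewrite /tau mulrC divfK// addrC subrK.
(* The two end pieces of the loop, already in [W], stay fixed; the middle follows the projection of
   [K]. *)
pose H (z : R * R) := if z.2 <= d then gc z.2 else
  if z.2 <= 1 - d then f (K (z.1, tau z.2)) else gc z.2.
have csnd : continuous (snd : R * R -> R) by move=> z; exact: cvg_snd.
have cfst : continuous (fst : R * R -> R) by move=> z; exact: cvg_fst.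
have cgs : continuous (fun z : R * R => gc z.2).
  exact: continuous_fun_comp csnd cgc.
have cH : continuous H.
  apply: (@glue_continuous _ _ _ snd) => //.
  - by move=> z _; exact: cgs.
  - move=> z _; apply: (@glue_continuous _ _ _ snd) => //.
    + move=> w _; apply: (continuous_fun_comp _ f_cont).
      apply: (continuous_fun_comp _ cK); apply: continuous_pair => //.
      exact: continuous_fun_comp csnd ctau.
    + by move=> w _; exact: cgs.
    + move=> w ->; rewrite (_ : tau _ = 1) ?(Ks _).2 ?fk//.
      by rewrite /tau (_ : _ - _ = 1 - 2 * d) ?divff//; lra.
  - move=> z ->; rewrite ifT; last lra.
    by rewrite /tau subrr mul0r (Ks _).1 fea sg0.
have HD (s t : R) : t \in `]0, 1[ -> D (H (s, t)).
  rewrite in_itv /= => /andP[t0 t1]; rewrite /H /=.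
  case: ifP => _; first by case: (gVD t t0 t1).
  by case: ifP => _ //; case: (gVD t t0 t1).
have H00 s : H (s, 0) = y by rewrite /H /= ltW// /gc clamp0.
have H01 s : H (s, 1) = y.
  rewrite /H /= ifF; last by apply/negbTE; lra.
  by rewrite ifF ?/gc ?clamp1//; apply/negbTE; lra.
exists (fun t => H (1, t)).
  split; last first.
    move=> t t01; split; last exact: HD.
    apply: WN; rewrite /H /=; case: ifP => [/gd0//|_].
    case: ifP => [_|/negbT]; first by rewrite K1.
    by rewrite -ltNge => /ltW/gd1.
  split => //; apply: continuous_subspaceT.
  apply: (continuous_fun_comp _ cH); apply: continuous_pair => t;
    [exact: cvg_cst | exact: cvg_id].
exists H; last by move=> s t _; exact: HD.
split => //; first exact: continuous_subspaceT.
move=> t t01; rewrite /H /=.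
have gct : gc t = g t by rewrite /gc clamp_id.
case: ifP => // /negbT; rewrite -ltNge => /ltW dt; case: ifP => // td.
by rewrite K0 fk sgc /sg affK.
Qed.

(** A path in [E] that tends to [x] in [X]. It is parametrized by a half-line because [x] may lie
    outside the image of [i]. *)
Lemma ray_to x V : connected_open_nbhs (p x) V ->
  exists r : R -> E, [/\ continuous r, forall u, comp V x (i (r u)) &
    forall W, connected_open_nbhs (p x) W -> exists n : nat,
      forall u, n%:R <= u -> comp W x (i (r u))].
Proof.
move=> [[oV Vx] cV].
have [U [UP US UV UB]] := connected_nbhs_sequence lpcY Y2 (open_nbhsP oV Vx).
have oU n : open (U n) by have [[]] := UP n.
have [|||r [cr r0 rU]] := @infinite_path R E (fun n => i @^-1` comp (U n) x).
- by move=> n e; apply: comp_mono; exact: US.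
- by move=> n; have [[_ Ux] _] := UP n; have [e] := comp_meets (oU n) Ux; exists e.
- by move=> n e e' xe xe'; exact: comp_path_in.
exists r; split => //; first by move=> u; apply: comp_mono UV _ (r0 u).
move=> W [[oW Wx] cW]; have [n UW] := UB _ (open_nbhsP oW Wx).
by exists n => u nu; apply: comp_mono UW _ (rU n u nu).
Qed.

Lemma line_between x x' V : connected_open_nbhs (p x) V -> comp V x x' ->
  p x' = p x ->
  exists l : R -> E, [/\ continuous l, forall u, comp V x (i (l u)) &
    forall W, connected_open_nbhs (p x) W -> exists n : nat, forall u : R,
      (u <= - n%:R -> comp W x (i (l u))) /\
      (n.+1%:R <= u -> comp W x' (i (l u)))].
Proof.
move=> xV xx' px'; have [[oV Vx] cV] := xV.
have [r [cr rV rW]] := ray_to xV.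
have x'V : connected_open_nbhs (p x') V by rewrite px'.
have [r' [cr' r'V r'W]] := ray_to x'V; rewrite px' in r'W.
have {}r'V u : comp V x (i (r' u)) by rewrite (same_connected_component xx').
have [m [cm m0 m1 mV]] := comp_path_in oV (rV 0) (r'V 0).
exists (fun u => if u <= 0 then r (- u) else if u <= 1 then m u else r' (u - 1)).
split.
- apply: (@glue_continuous _ _ _ id) => [u|u _|u _|u ->].
  + exact: cvg_id.
  + by apply: (continuous_fun_comp _ cr) => w; apply: cvgN; exact: cvg_id.
  + apply: (@glue_continuous _ _ _ id) => [w|w _|w _|w ->].
    * exact: cvg_id.
    * exact: cm.
    * apply: (continuous_fun_comp _ cr') => z.
      by apply: cvgB; [exact: cvg_id | exact: cvg_cst].
    * by rewrite m1 subrr.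
  + by rewrite ler01 m0 oppr0.
- by move=> u; case: ifP => // _; case: ifP => // _; exact: mV.
move=> W xW; have [n rn] := rW W xW; have [n' rn'] := r'W W xW.
(* The bound [n.+1] in the second clause absorbs the unit of time spent on [m]. *)
exists (maxn n n') => u; split => un.
  have nn : n%:R <= (maxn n n')%:R :> R by rewrite ler_nat leq_maxl.
  have n0 : 0 <= (maxn n n')%:R :> R by rewrite ler0n.
  by rewrite ifT; [apply: rn; lra | lra].
have nn : n'%:R <= (maxn n n')%:R :> R by rewrite ler_nat leq_maxr.
have n0 : 0 <= n'%:R :> R by rewrite ler0n.
rewrite -natr1 in un; rewrite ifF; last by apply/negbTE; lra.
case: ifP => [u1|_]; last by apply: rn'; lra.
have -> : u = 1 by lra.
by rewrite m1; apply: rn'; lra.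
Qed.

(** A line in [E] from [x] to [x'] projects to a loop at [p x]. Deforming the loop into [W] and
    lifting the deformation shows that both points lie in one component over [W]; as [W] is
    arbitrary, they coincide. *)
Lemma slsc_in_discrete : semi_locally_simply_connected_in R D ->
  has_discrete_fibers p.
Proof.
move=> [_ slsc]; apply/discrete_fibersP => x.
have [V xV triv] := slsc (p x); exists V => // x' xx' px'.
have [l [cl lV lW]] := line_between xV xx' px'.
have lVf u : V (f (l u)) by have := comp_in (lV u); rewrite pi.
(* An increasing homeomorphism from ]0, 1[ onto the line. *)
pose hh (t : R) := (1 - t)^-1 - t^-1.
have chh (t : R) : 0 < t -> t < 1 -> {for t, continuous hh}.
  move=> t0 t1; apply: cvgB.
    apply: cvgV; first by rewrite gt_eqF// subr_gt0.
    by apply: cvgB; [exact: cvg_cst | exact: cvg_id].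
  by apply: cvgV; [rewrite gt_eqF | exact: cvg_id].
have lhh W : connected_open_nbhs (p x) W -> exists d : R, [/\ 0 < d, d < 2^-1,
    forall t, 0 < t -> t <= d -> comp W x (i (l (hh t))) &
    forall t, 1 - d <= t -> t < 1 -> comp W x' (i (l (hh t)))].
  (* For [t] at most this bound, [t^-1] is at least [n + 4] and [(1 - t)^-1] at most 2, so
     [hh t <= - n - 2]; symmetrically [hh] is at least [n + 2] near 1. *)
  move=> xW; have [n ln] := lW W xW; exists (n%:R + 4)^-1.
  have n0 : 0 <= n%:R :> R by rewrite ler0n.
  have d4 : (n%:R + 4)^-1 <= 4^-1 :> R by rewrite lef_pV2 ?posrE; lra.
  have near0 (t : R) : 0 < t -> t <= (n%:R + 4)^-1 ->
      (1 - t)^-1 <= 2 /\ n%:R + 4 <= t^-1.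
    move=> t0 td; split.
      by rewrite -[X in _ <= X]invrK lef_pV2 ?posrE; lra.
    by rewrite -[X in X <= _]invrK lef_pV2 ?posrE// invr_gt0; lra.
  split; first by rewrite invr_gt0; lra.
  - lra.
  - move=> t t0 td; apply: (ln _).1; have [h1 h2] := near0 t t0 td.
    by rewrite /hh; lra.
  - move=> t td t1; apply: (ln _).2; rewrite -natr1.
    have [||h1 h2] := near0 (1 - t); [lra | lra |].
    by rewrite /hh; move: h1; rewrite (_ : 1 - (1 - t) = t); lra.
pose g (t : R) := if (0 < t) && (t < 1) then f (l (hh t)) else p x.
have gE t : 0 < t -> t < 1 -> g t = f (l (hh t)) by rewrite /g => -> ->.
have gOmega : Omega (p x) (V `&` D) g.
  split; last first.
    by move=> t; rewrite in_itv /= => /andP[t0 t1]; rewrite gE.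
  split; last 2 first.
  - by rewrite /g ltxx.
  - by rewrite /g ltxx andbF.
  apply/subspace_continuousP => t t01 N gN.
  suff : nbhs t [set u | u \in `[0, 1] -> N (g u)] by [].
  move: t01; rewrite /= in_itv /= => /andP[t0 t1].
  have ends : N (p x) -> nbhs (p x) N -> exists d : R, [/\ 0 < d, d < 2^-1,
      forall u, u <= d -> N (g u) & forall u, 1 - d <= u -> N (g u)].
    move=> Nx /(lpc_connected_nbhs lpcY)[W [oW WN cW]].
    have [d [d0 d2 ld0 ld1]] := lhh W (conj oW cW).
    exists d; split => // u ud; rewrite /g; case: ifP => // /andP[u0 u1]; apply: WN.
      by have := comp_in (ld0 u u0 ud); rewrite pi.
    by have := comp_in (ld1 u ud u1); rewrite pi.
  have [t0'|t0'] := leP t 0.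
    have tE : t = 0 by lra.
    have {}gN : nbhs (p x) N by move: gN; rewrite /from_subspace tE /g ltxx.
    rewrite tE.
    have [d [d0 _ gd _]] := ends (nbhs_singleton gN) gN.
    by apply: (filterS _ (lt_nbhsl d0)) => u /= /ltW ud _; exact: gd.
  have [t1'|t1'] := leP 1 t.
    have tE : t = 1 by lra.
    have {}gN : nbhs (p x) N by move: gN; rewrite /from_subspace tE /g ltxx andbF.
    rewrite tE.
    have [d [d0 _ _ gd]] := ends (nbhs_singleton gN) gN.
    have d1 : 1 - d < 1 by lra.
    by apply: (filterS _ (lt_nbhsr d1)) => u /= /ltW ud _; exact: gd.
  rewrite /from_subspace gE// in gN.
  have lN : nbhs t (hh @^-1` (l @^-1` (f @^-1` N))).
    by apply: (chh t t0' t1'); apply: cl; exact: f_cont.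
  apply: (filterS _ (filterI lN (filterI (lt_nbhsr t0') (lt_nbhsl t1')))).
  by move=> u [Nu [u0 u1]] _; rewrite gE.
apply/esym/fiber_separated => [//|W xW].
have [[oW Wx] cW] := xW.
have [h [[ch h0 h1] hW] [H [cH H0 H1 Hs0 Hs1] HD]] := triv g gOmega W (conj oW Wx).
pose Hc (z : R * R) := H (clamp z.1, clamp z.2).
have cHc : continuous Hc by exact: clamp_square_continuous.
(* The ends of the loop are fixed at [p x], so near them the whole deformation stays in [W]. *)
have [e0 e00 He0] : exists2 e : R, 0 < e &
    forall s t, s \in `[0, 1] -> `|0 - t| < e -> W (Hc (s, t)).
  apply: tube => // s s01; rewrite /Hc /= clamp0 Hs0//; exact: clamp_in.
have [e1 e10 He1] : exists2 e : R, 0 < e &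
    forall s t, s \in `[0, 1] -> `|1 - t| < e -> W (Hc (s, t)).
  apply: tube => // s s01; rewrite /Hc /= clamp1 Hs1//; exact: clamp_in.
have [d1 [d10 d12 ld0 ld1]] := lhh W xW.
have [d [d0 d2 dd1 de0 de1]] : exists d : R,
    [/\ 0 < d, d < 2^-1, d <= d1, d < e0 & d < e1].
  exists (Num.min (Num.min e0 e1) d1 / 2).
  have m0 : 0 < Num.min (Num.min e0 e1) d1 by rewrite !lt_min e00 e10 d10.
  have ma : Num.min (Num.min e0 e1) d1 <= e0 by rewrite !ge_min lexx.
  have mb : Num.min (Num.min e0 e1) d1 <= e1 by rewrite !ge_min lexx orbT.
  have m2 : Num.min (Num.min e0 e1) d1 <= d1 by rewrite !ge_min lexx orbT.
  by move: (Num.min _ _) m0 ma mb m2 => m m0 ma mb m2; split; lra.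
pose aff := shrink d.
have caff : continuous aff by exact: shrink_continuous.
have aff_in t : d <= aff t /\ aff t <= 1 - d by apply: shrink_bounds; exact: ltW.
have aff_oo t : aff t \in `]0, 1[.
  by rewrite in_itv /=; have [? ?] := aff_in t; apply/andP; split; lra.
have aff_cc t : clamp (aff t) = aff t.
  have [? ?] := aff_in t.
  by apply: clamp_id; rewrite in_itv /=; apply/andP; split; lra.
have aff0 : aff 0 = d := shrink0 d.
have aff1 : aff 1 = 1 - d := shrink1 d.
have csnd : continuous (snd : R * R -> R) by move=> z; exact: cvg_snd.
have cfst : continuous (fst : R * R -> R) by move=> z; exact: cvg_fst.
(* The parameters are exchanged: the lift proceeds in the deformation direction, starting from the
   known lift of the truncated loop. *)
pose G (z : R * R) := Hc (z.2, aff z.1).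
have [|||||K [cK K0 fK]] := @homotopy_lift _ _ R _ _ fD G (fun a => l (hh (aff a))).
- apply: (continuous_fun_comp _ cHc); apply: continuous_pair => //.
  exact: continuous_fun_comp cfst caff.
- by move=> z; rewrite /G /Hc /= aff_cc; apply: HD => //; exact: clamp_in.
- by move=> a b; rewrite /G /Hc /= clampK.
- apply: (continuous_fun_comp _ cl) => a; have := aff_oo a; rewrite in_itv /=.
  move=> /andP[a0 a1]; apply: continuous_atI => N /(nbhs_preimage (chh _ a0 a1)).
  exact: (nbhs_preimage (caff a)).
- move=> a; have := aff_oo a; rewrite /G /Hc /= aff_cc clamp0 => a01.
  rewrite H0; last by rewrite -aff_cc clamp_in.
  by move: a01; rewrite in_itv /= => /andP[a0 a1]; rewrite gE.
have cK1 a : continuous (fun b => K (a, b)).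
  by apply: (continuous_fun_comp _ cK); apply: continuous_pair => b;
    [exact: cvg_cst | exact: cvg_id].
have cK2 b : continuous (fun a => K (a, b)).
  by apply: (continuous_fun_comp _ cK); apply: continuous_pair => a;
    [exact: cvg_id | exact: cvg_cst].
have GcE b t : G (b, t) = Hc (clamp t, aff b) by rewrite /G /Hc /= clampK.
(* Three sides of the lifted square lie over [W]: the two lateral ones by the tube estimates, the
   last one because the deformed loop is in [W]. Together they link [x] to [x'] over [W]. *)
have x0 : comp W x (i (K (0, 1))).
  apply: (@comp_along_path W x (fun b => K (0, b)) 0 1 (cK1 0)) => [b|].
    by rewrite fK GcE aff0; apply: He0; rewrite ?clamp_in// sub0r normrN gtr0_norm.
  by rewrite K0 aff0; exact: ld0.
have x1 : comp W x' (i (K (1, 1))).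
  apply: (@comp_along_path W x' (fun b => K (1, b)) 0 1 (cK1 1)) => [b|].
    rewrite fK GcE aff1; apply: He1; rewrite ?clamp_in// subKr gtr0_norm//.
  by rewrite K0 aff1; apply: ld1; lra.
have x01 : comp W x (i (K (1, 1))).
  apply: (@comp_along_path W x (fun a => K (a, 1)) 0 1 (cK2 1)) => // a.
  rewrite fK /G /Hc /= clamp1 aff_cc H1; last by rewrite -aff_cc clamp_in.
  by have [] := hW _ (aff_oo a).
by apply: connected_component_trans x01 _; exact: connected_component_sym.
Qed.

End BranchedSpread.

(** * Equivalence of the three conditions *)

Unset Implicit Arguments.

Theorem proposition2p39 (R : realType) (Y : topologicalType) (S : set Y)
    (Yconnected : connected [set: Y])
    (Ylpc : locally_path_connected R Y)
    (Ysc : @second_countable Y)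
    (Yhausdorff : hausdorff_space Y)
    (Sskeletal : skeletal S)
    (YSslsc : semi_locally_simply_connected R (set_type (~` S)))
    (X : topologicalType) (p : X -> Y)
    (Xspace : standing_space R X)
    (puniv : universal_covering_possibly_branched_over R S p) :
  (Galoisian p <-> (branched_covering p /\ has_discrete_fibers p)) /\
  ((branched_covering p /\ has_discrete_fibers p) <->
     semi_locally_simply_connected_in R (~` S)).
Proof.
have [E [q [i [[_ lpcE _] [cq scE] [_ cp emb pif portlyi]]]]] := puniv.
have [hX lpcX _] := Xspace.
have [oD _ _] : portly (~` S) := Sskeletal.
have [[e0 _] _ _] := scE.
have fD := covers_of_covering oD e0 cq.
have pi e : p (i e) = (set_val \o q) e by rewrite -pif.
have bc : branched_covering p.
  exact: (@branched_covering_completion R E Y X (~` S) (set_val \o q) p i).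
have dG : has_discrete_fibers p -> Galoisian p.
  exact: (@discrete_Galoisian R E Y X (~` S) (set_val \o q) p i).
have Gd : Galoisian p -> has_discrete_fibers p.
  exact: (@Galoisian_discrete R E Y X (~` S) (set_val \o q) p i).
have ds : has_discrete_fibers p -> semi_locally_simply_connected_in R (~` S).
  exact: (@discrete_slsc_in R E Y X (~` S) (set_val \o q) p i).
have sd : semi_locally_simply_connected_in R (~` S) -> has_discrete_fibers p.
  exact: (@slsc_in_discrete R E Y X (~` S) (set_val \o q) p i).
split; split; [by move=> /Gd | by move=> [_ /dG] | by move=> [_ /ds] |].
by move=> /sd.
Qed.
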